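(* Let $V$ be a vertex algebra, $g$ an automorphism of $V$ of finite order $T$, $(W,Y_W)$ a $g$-twisted $\phi$-coordinated $V$-module and $n\in(1/T)\mathbb N$. Then $\tilde\Omega_n(W)$ is invariant under $o(v)$ for all $v\in V$, and it is an $\tilde A_{g,n}(V)$-module with $v+\tilde O_{g,n}(V)$ acting as $o(v)$.
   Context: $V$ is a vertex algebra with vacuum $\mathbf 1$, $Y(v,x)=\sum_kv_kx^{-k-1}$, $\mathcal Dv=v_{-2}\mathbf 1$; $g^T=1$; $V=\bigoplus_{r=0}^{T-1}V^r$, $V^r=\{v: gv=e^{-2\pi\sqrt{-1}r/T}v\}$. A $g$-twisted $\phi$-coordinated $V$-module is a vector space $W$ with a linear map $Y_W(\cdot,x):V\to\mathrm{Hom}(W,W((x^{1/T})))$, $Y_W(v,x)=\sum_{n\in(1/T)\mathbb Z}v_nx^{-n-1}$, such that: (i) $Y_W(\mathbf 1,x)=\mathrm{id}_W$; (ii) $Y_W(gv,x)=\lim_{x^{1/T}\to\omega_T^{-1}x^{1/T}}Y_W(v,x)$, $\omega_T=e^{-2\pi\sqrt{-1}/T}$; (iii) for $u,v$ there is $k\in\mathbb N$ with $(x_1-x_2)^kY_W(u,x_1)Y_W(v,x_2)\in\mathrm{Hom}(W,W((x_1^{1/T},x_2^{1/T})))$ and $x_2^k(e^{x_0}-1)^kY_W(Y(u,x_0)v,x_2)=\big((x_1-x_2)^kY_W(u,x_1)Y_W(v,x_2)\big)|_{x_1^{1/T}=(x_2e^{x_0})^{1/T}}$. $o_i(u)=u_{-i-1}$,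 $o(u)=o_0(u)=u_{-1}$; $\tilde\Omega_n(W)=\{w: o_k(v)w=0\ \forall v\in V,\ k\in(1/T)\mathbb Z,\ k<-n\}$. For $k,l\in\{0,\dots,T-1\}$, $\delta_k(l)=1$ if $k\ge l$, $0$ if $k<l$, $\delta_k(T)=0$; $n=\lfloor n\rfloor+\bar n/T$, $\bar n\in\{0,\dots,T-1\}$. $(1+y)^\alpha$ expanded in nonnegative powers of $y$; $Y(u,\log(1+y))v$ is $Y(u,x)v$ at $x=\log(1+y)$. For $u\in V^r$, $v\in V$: $u\bullet_{g,n}v=\sum_{i=0}^{\lfloor n\rfloor}(-1)^i\binom{\lfloor n\rfloor+i}{i}\operatorname{Res}_y\frac{(1+y)^{-1+\lfloor n\rfloor+\delta_{\bar n}(r)+r/T}}{y^{\lfloor n\rfloor+i+1}}Y(u,\log(1+y))v$ if $r=0$ and $u\bullet_{g,n}v=0$ if $r\neq0$; $u\diamond_{g,n}v=\operatorname{Res}_y\frac{(1+y)^{-1+\delta_{\bar n}(r)+\lfloor n\rfloor+r/T}}{y^{2\lfloor n\rfloor+\delta_{\bar n}(r)+\delta_{\bar n}(T-r)+1}}Y(u,\log(1+y))v$. $\tilde O_{g,n}(V)=\mathrm{span}\{u\diamond_{g,n}v:u,v\in V\}+\mathcal D V$, and $\tilde A_{g,n}(V)=V/\tilde O_{g,n}(V)$ is an associative algebra with product induced by $\bullet_{g,n}$ and unit $\mathbf 1+\tilde O_{g,n}(V)$. *)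

(* Defs.v *)
From HB Require Import structures.
From mathcomp Require Import all_boot all_order all_algebra.
From mathcomp Require Import complex Rstruct.
From Stdlib Require Reals ClassicalEpsilon.

Set Implicit Arguments.
Unset Strict Implicit.
Unset Printing Implicit Defensive.
Import Order.TTheory GRing.Theory Num.Theory.
Local Open Scope ring_scope.

Notation CC := (Rdefinitions.R[i]).

Definition omegaT (T : nat) : CC :=
  Complex (Rtrigo_def.cos (2 * Rtrigo1.PI / T%:R))
          (- Rtrigo_def.sin (2 * Rtrigo1.PI / T%:R)).

(* Sum over the integers i >= lo of a family f that vanishes for all large i
   (the infinite sums occurring below are all of this kind): we sum f over
   [lo, N) for a (classically chosen) N beyond which f vanishes. *)
Definition fsum {M : zmodType} (lo : int) (f : int -> M) : M :=
  let N := ClassicalEpsilon.epsilon (inhabits (0 : int))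
             (fun N : int => forall i : int, N <= i -> f i = 0) in
  \sum_(0 <= t < absz (N - lo)) f (lo + t%:Z).

Definition is_linear {R : pzRingType} {U W : lmodType R} (f : U -> W) : Prop :=
  forall (a : R) (x y : U), f (a *: x + y) = a *: f x + f y.

Definition gbin (alpha : CC) (i : nat) : CC :=
  (\prod_(t < i) (alpha - t%:R)) / (i`!)%:R.

Section VertexAlgebra.
Variable V : lmodType CC.
(* mode u k v = u_k v, i.e. Y(u,x)v = sum_k (mode u k v) x^{-k-1} *)
Variable mode : V -> int -> V -> V.
Variable vac : V.

(* Vertex algebra (Lepowsky-Li), with the Jacobi identity written in its
   equivalent component form (Borcherds identity). *)
Record vertex_algebra : Prop := {
  va_lin_l : forall k v, is_linear (fun u => mode u k v);
  va_lin_r : forall u k, is_linear (mode u k);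
  va_trunc : forall u v, exists N : int, forall k, N <= k -> mode u k v = 0;
  va_vacuum : forall k v, mode vac k v = if k == -1 then v else 0;
  va_creation_reg : forall v k, 0 <= k -> mode v k vac = 0;
  va_creation : forall v, mode v (-1) vac = v;
  va_jacobi : forall u v w (p q r : int),
    fsum 0 (fun i => gbin p%:~R (absz i) *: mode (mode u (r + i) v) (p + q - i) w)
    = fsum 0 (fun i => ((-1) ^+ absz i * gbin r%:~R (absz i)) *:
                 (mode u (p + r - i) (mode v (q + i) w)
                  - (-1) ^ r *: mode v (q + r - i) (mode u (p + i) w)))
}.

Definition vaD (v : V) : V := mode v (-2) vac.

Definition va_automorphism (g : V -> V) : Prop :=
  [/\ is_linear g, bijective g, g vac = vac &
      forall u k v, g (mode u k v) = mode (g u) k (g v)].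

Definition has_order (g : V -> V) (T : nat) : Prop :=
  [/\ (0 < T)%N, forall v, iter T g v = v &
      forall k, (0 < k < T)%N -> exists v, iter k g v <> v].

Variable g : V -> V.
Variable T : nat.

Definition in_Vr (r : nat) (v : V) : Prop := g v = (omegaT T) ^+ r *: v.

Definition projVr (r : nat) (u : V) : V :=
  (T%:R)^-1 *: \sum_(j < T) ((omegaT T) ^+ (r * j))^-1 *: iter j g u.

Definition psmul (f h : nat -> CC) (n : nat) : CC :=
  \sum_(i < n.+1) f i * h (n - i)%N.
Definition ps1 (n : nat) : CC := (n == 0%N)%:R.
Definition pspow (f : nat -> CC) (e : nat) : nat -> CC := iter e (psmul f) ps1.
(* inverse of a power series with constant term 1:  1/f = sum_k (1-f)^k *)
Definition psinv (f : nat -> CC) (n : nat) : CC :=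
  \sum_(k < n.+1) pspow (fun m => ps1 m - f m) k n.
Definition pspowz (f : nat -> CC) (e : int) : nat -> CC :=
  match e with Posz k => pspow f k | Negz k => pspow (psinv f) k.+1 end.
(* log(1+y) = y * logL(y) *)
Definition logL (j : nat) : CC := (-1) ^+ j / (j.+1)%:R.
Definition binser (alpha : CC) (j : nat) : CC := gbin alpha j.

(* coefficient of y^M in (1+y)^alpha (log(1+y))^e, e an integer *)
Definition rescoef (alpha : CC) (M : nat) (e : int) : CC :=
  if e <= M%:Z then psmul (binser alpha) (pspowz logL e) (absz (M%:Z - e))
  else 0.

(* Res_y (1+y)^alpha / y^(M+1) * Y(u, log(1+y)) v
   = sum_i [y^M]((1+y)^alpha (log(1+y))^(-i-1)) u_i v *)
Definition resY (alpha : CC) (M : nat) (u v : V) : V :=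
  fsum (- M%:Z - 1) (fun i => rescoef alpha M (- i - 1) *: mode u i v).

Definition deltaT (k l : nat) : nat := if l == T then 0%N else (l <= k)%N.

(* n = p / T, floor n = p %/ T, bar n = p %% T *)
Variable p : nat.
Definition fl : nat := (p %/ T)%N.
Definition nb : nat := (p %% T)%N.

Definition bullet_r (r : nat) (u v : V) : V :=
  if r == 0%N then
    \sum_(i < fl.+1)
      ((-1) ^+ i * ('C(fl + i, i))%:R) *:
        resY (-1 + fl%:R + (deltaT nb r)%:R + r%:R / T%:R) (fl + i) u v
  else 0.

Definition diamond_r (r : nat) (u v : V) : V :=
  resY (-1 + (deltaT nb r)%:R + fl%:R + r%:R / T%:R)
       (2 * fl + deltaT nb r + deltaT nb (T - r)) u v.

Definition bullet (u v : V) : V :=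
  \sum_(r < T) bullet_r r (projVr r u) v.

Definition in_Otilde (x : V) : Prop :=
  exists (m : nat) (c : 'I_m -> CC) (r : 'I_m -> nat) (a b : 'I_m -> V) (d : V),
    (forall i, (r i < T)%N /\ in_Vr (r i) (a i)) /\
    x = \sum_(i < m) c i *: diamond_r (r i) (a i) (b i) + vaD d.

End VertexAlgebra.

Section TwistedModule.
Variable V : lmodType CC.
Variable mode : V -> int -> V -> V.
Variable vac : V.
Variable g : V -> V.
Variable T : nat.
Variable W : lmodType CC.
(* wmode v m w = v_{m/T} w, i.e. Y_W(v,x)w = sum_m (wmode v m w) x^{-m/T-1} *)
Variable wmode : V -> int -> W -> W.

(* coefficient of x1^{a/T} x2^{b/T} in (x1-x2)^k Y_W(u,x1) Y_W(v,x2) w *)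
Definition prodcoef (u v : V) (k : nat) (w : W) (a b : int) : W :=
  \sum_(j < k.+1)
    ((-1) ^+ j * ('C(k, j))%:R) *:
      wmode u (T%:Z * (k%:Z - j%:Z - 1) - a) (wmode v (T%:Z * (j%:Z - 1) - b) w).

(* coefficient of x0^l in (e^{x0} - 1)^k *)
Definition expm1pow (k l : nat) : CC :=
  (\sum_(i < k.+1) ((-1) ^+ (k - i) * ('C(k, i))%:R * (i%:R) ^+ l)) / (l`!)%:R.

(* coefficient of x0^j x2^{c/T} in x2^k (e^{x0}-1)^k Y_W(Y(u,x0)v, x2) w *)
Definition lhscoef (u v : V) (k : nat) (w : W) (j c : int) : W :=
  wmode (fsum 0 (fun l => expm1pow k (absz l) *: mode u (l - j - 1) v))
        (T%:Z * (k%:Z - 1) - c) w.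

(* coefficient of x0^j x2^{c/T} in
   ((x1-x2)^k Y_W(u,x1)Y_W(v,x2)w)|_{x1^{1/T} = (x2 e^{x0})^{1/T}},
   given that the coefficient of x1^{a/T}x2^{b/T} vanishes when a < N or b < N
   (so x1^{a/T} x2^{b/T} |-> x2^{(a+b)/T} e^{a x0/T}) *)
Definition rhscoef (u v : V) (k : nat) (w : W) (N j c : int) : W :=
  if 0 <= j then
    fsum N (fun a => if a <= c - N then
                       ((a%:~R / T%:R) ^+ absz j / ((absz j)`!)%:R) *:
                         prodcoef u v k w a (c - a)
                     else 0)
  else 0.

Record twisted_phi_module : Prop := {
  tm_lin_l : forall m w, is_linear (fun v => wmode v m w);
  tm_lin_r : forall v m, is_linear (wmode v m);
  tm_trunc : forall v w, exists N : int, forall m, N <= m -> wmode v m w = 0;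
  tm_vacuum : forall m w, wmode vac m w = if m == - T%:Z then w else 0;
  (* (ii) Y_W(gv,x) = lim_{x^{1/T} -> omega_T^{-1} x^{1/T}} Y_W(v,x) *)
  tm_twist : forall v m w,
    wmode (g v) m w = ((omegaT T)^-1) ^ (- m - T%:Z) *: wmode v m w;
  tm_assoc : forall u v, exists k : nat, forall w, exists N : int,
    (forall a b : int, (a < N \/ b < N) -> prodcoef u v k w a b = 0) /\
    (forall j c : int, lhscoef u v k w j c = rhscoef u v k w N j c)
}.

Definition ozero (v : V) (w : W) : W := wmode v (- T%:Z) w.

(* Omega~_n(W) for n = p/T: o_k(v) w = 0 for all v, k in (1/T)Z, k < -n,
   where o_k(v) = v_{-k-1}; with k = m/T this is wmode v (-m-T). *)
Definition Omega_tilde (p : nat) (w : W) : Prop :=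
  forall (v : V) (m : int), m < - p%:Z -> wmode v (- m - T%:Z) w = 0.

End TwistedModule.

(* Main.v *)
Require Import Defs.
From HB Require Import structures.
From mathcomp Require Import all_boot all_order all_algebra.
From mathcomp Require Import complex Rstruct.
From mathcomp Require Import zify ring.
Import Order.TTheory GRing.Theory Num.Theory.
Set Implicit Arguments.
Unset Strict Implicit.
Unset Printing Implicit Defensive.
Local Open Scope ring_scope.

(* Write P(a,b) for the coefficient of x1^(a/T) x2^(b/T) in
   (x1 - x2)^k Y_W(u,x1) Y_W(v,x2) w.  After the substitution x0 = log(1+y),
   associativity says that o_d of Res_y (1+y)^al y^(-M-1) Y(u,log(1+y)) v acts on w as
   the sum over a of binom(al + a/T, M+k) P(a, dT + kT - a) (wcoef_resY).  Skew symmetry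
   of V and the linear independence of the exponentials e^(a x0/T) give weak
   commutativity (prodcoef_comm), so that for w in Omega~_n(W) the support of P is
   bounded below by -n in both variables.  For the diamond product every binomial
   coefficient then vanishes on the support of P.  For the bullet product, and for
   o_a(u) o(v) w with a < -n, the binomial sums coincide with those obtained by expanding
   (x1 - x2)^(-k) P; in the second case the result is o_a(x) w for some x in V, hence 0. *)

(** * Formal power series *)

Lemma exchange_triangle (M : nmodType) (F : nat -> nat -> M) (n : nat) :
  \sum_(i < n) \sum_(j < i.+1) F j (i - j)%N
  = \sum_(j < n) \sum_(i < (n - j)%N) F j i.
Proof.
elim: n => [|n IHn]; first by rewrite !big_ord0.
rewrite big_ord_recr /= IHn [RHS]big_ord_recr /= subSnn big_ord1.
rewrite [\sum_(j < n.+1) _]big_ord_recr /= subnn addrA; congr (_ + _).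
rewrite -big_split; apply: eq_bigr => j _ /=.
by rewrite subSn ?big_ord_recr // ltnW.
Qed.

(** The action of scalar power series on series with coefficients in a vector space; [psmul] is its
    scalar case. *)
Definition conv (W : lmodType CC) (c : nat -> CC) (f : nat -> W) (n : nat) : W :=
  \sum_(l < n.+1) c l *: f (n - l)%N.

Section Convolution.
Variable W : lmodType CC.
Implicit Types (c d : nat -> CC) (f h : nat -> W).

Lemma psmul_conv c d n : psmul c d n = conv (W := CC^o) c d n.
Proof. by []. Qed.

Lemma eq_conv c d f h n :
  (forall i, (i <= n)%N -> c i = d i) -> (forall i, (i <= n)%N -> f i = h i) ->
  conv c f n = conv d h n.
Proof.
move=> cd fh; apply: eq_bigr => i _; have := ltn_ord i => lt_in.
by rewrite cd ?fh // leq_subr.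
Qed.

Lemma convA c d f n : conv c (conv d f) n = conv (psmul c d) f n.
Proof.
(* Both sides are padded to sums over a cube, with the indicator of i + j + l = n. *)
pose G i j l : W := if (i + j + l == n)%N then (c i * d j) *: f l else 0.
pose S := \sum_(i < n.+1) \sum_(j < n.+1) \sum_(l < n.+1) G i j l.
have single m (F : nat -> W) : (m <= n)%N ->
    \sum_(l < n.+1) (if (l == m :> nat) then F l else 0) = F m.
  move=> le_mn; rewrite -big_mkcond /= (big_pred1 (inord m)).
    by rewrite inordK.
  by move=> i /=; rewrite -[i == _]val_eqE /= inordK.
have eqv (i j l : nat) : (i + j <= n)%N -> (l == n - i - j)%N = (i + j + l == n)%N.
  by move=> le_n; apply/eqP/eqP; lia.
transitivity S.
  apply: eq_bigr => i _; have := ltn_ord i => lt_in; rewrite scaler_sumr.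
  rewrite [LHS](big_ord_widen_cond n.+1 predT
    (fun j => c i *: (d j *: f (n - i - j)%N))); last lia.
  rewrite big_mkcond; apply: eq_bigr => j _ /=; have := ltn_ord j => lt_jn.
  case: ifP => le_ij.
    rewrite -(single (n - i - j)%N (fun l => c i *: (d j *: f l))); last lia.
    apply: eq_bigr => l _; rewrite /G scalerA.
    by rewrite (eqv i j l) //; lia.
  rewrite big1 // => l _; rewrite /G.
  by have -> : (i + j + l == n)%N = false by apply/eqP; lia.
transitivity (\sum_(l < n.+1) \sum_(i < n.+1) \sum_(j < n.+1) G i j l).
  by rewrite /S exchange_big; under eq_bigr do rewrite exchange_big;
     rewrite exchange_big; apply: eq_bigr => l _; rewrite exchange_big.
rewrite /conv [RHS](reindex_inj rev_ord_inj) /=; apply: eq_bigr => l _.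
have := ltn_ord l => lt_ln.
rewrite /psmul subSS scaler_suml.
have -> : (n - (n - l))%N = l by lia.
rewrite [RHS](big_ord_widen_cond n.+1 predT
  (fun i => (c i * d (n - l - i)%N) *: f l)); last lia.
rewrite [RHS]big_mkcond; apply: eq_bigr => i _ /=; have := ltn_ord i => lt_in.
case: ifP => le_il.
  rewrite -(single (n - l - i)%N (fun j => (c i * d j) *: f l)); last lia.
  apply: eq_bigr => j _; rewrite /G.
  by rewrite (_ : (i + j + l = l + i + j)%N) ?(eqv l i j) //; lia.
rewrite big1 // => j _; rewrite /G.
by have -> : (i + j + l == n)%N = false by apply/eqP; lia.
Qed.

End Convolution.

Lemma eq_psmul c c' d d' n :
  (forall i, (i <= n)%N -> c i = c' i) -> (forall i, (i <= n)%N -> d i = d' i) ->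
  psmul c d n = psmul c' d' n.
Proof. by rewrite !psmul_conv; apply: eq_conv. Qed.

Lemma psmulA a b c n : psmul a (psmul b c) n = psmul (psmul a b) c n.
Proof. by rewrite !psmul_conv -convA; apply: eq_conv. Qed.

Lemma psmulC a b n : psmul a b n = psmul b a n.
Proof.
rewrite /psmul (reindex_inj rev_ord_inj) /=; apply: eq_bigr => i _.
by rewrite mulrC subSS subKn // -ltnS.
Qed.

Lemma psmul1s a n : psmul ps1 a n = a n.
Proof.
rewrite /psmul big_ord_recl /= mul1r subn0 big1 ?addr0 // => i _.
by rewrite /ps1 /= mul0r.
Qed.

Lemma psmuls1 a n : psmul a ps1 n = a n.
Proof. by rewrite psmulC psmul1s. Qed.

Lemma pspow_low f k n : f 0%N = 0 -> (n < k)%N -> pspow f k n = 0.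
Proof.
move=> f0; elim: k n => [//|k IHk] n ltnk; rewrite /= /psmul.
apply: big1 => -[[|i] lti] _ /=; first by rewrite f0 mul0r.
by rewrite IHk ?mulr0 //; lia.
Qed.

(** Geometric series in h = 1 - f. Since h has no constant term, h^k starts in degree k, so the
    truncation in [psinv] may be lengthened and the product telescopes. *)
Lemma psmul_psinv f n : f 0%N = 1 -> psmul f (psinv f) n = ps1 n.
Proof.
move=> f0; pose h m := ps1 m - f m.
have h0 : h 0%N = 0 by rewrite /h f0 subrr.
have psinvE N m : (m < N)%N -> psinv f m = \sum_(k < N) pspow h k m.
  move=> ltmN; rewrite /psinv (big_ord_widen_cond N predT
    (fun k => pspow (fun m => ps1 m - f m) k m)) //= big_mkcond.
  by apply: eq_bigr => k _; case: ltnP => // ltmk; rewrite pspow_low.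
have -> : psmul f (psinv f) n = psinv f n - psmul h (psinv f) n.
  rewrite -{1}(psmul1s (psinv f) n) /psmul -sumrB; apply: eq_bigr => i _.
  by rewrite /h mulrBl opprB addrC subrK.
rewrite (@psinvE n.+2 n) // big_ord_recl /=.
have -> : psmul h (psinv f) n = \sum_(k < n.+1) pspow h k.+1 n.
  rewrite /= /psmul exchange_big /=; apply: eq_bigr => i _.
  by rewrite -mulr_sumr (@psinvE n.+1) // ltnS leq_subr.
by rewrite addrK.
Qed.

Lemma pspowzS f e n : f 0%N = 1 -> pspowz f (e + 1) n = psmul f (pspowz f e) n.
Proof.
move=> f0; case: e => [k|[|k]].
- by have -> : k%:Z + 1 = k.+1%:Z by lia.
- have -> : Negz 0 + 1 = 0%:Z by lia.
  rewrite /= -(psmul_psinv n f0); apply: eq_psmul => // i _.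
  by rewrite psmuls1.
- have -> : Negz k.+1 + 1 = Negz k by lia.
  rewrite /= psmulA -[LHS]psmul1s; apply: eq_psmul => // i _.
  by rewrite psmul_psinv.
Qed.

Lemma pspowzD f e j n : f 0%N = 1 ->
  pspowz f (e + j%:Z) n = psmul (pspowz f e) (pspow f j) n.
Proof.
move=> f0; elim: j n => [|j IHj] n; first by rewrite addr0 psmuls1.
have -> : e + j.+1%:Z = e + j%:Z + 1 by lia.
rewrite pspowzS // (eq_psmul (c' := f) (d' := psmul (pspowz f e) (pspow f j))) //.
by rewrite /= psmulC -psmulA; apply: eq_psmul => // i _; rewrite psmulC.
Qed.

Lemma gbinS (a : CC) n : n.+1%:R * gbin a n.+1 = (a - n%:R) * gbin a n.
Proof.
rewrite /gbin big_ord_recr /= factS natrM invfM.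
have n0 : n.+1%:R != 0 :> CC by rewrite pnatr_eq0.
have shuffle (x y z t : CC) : x != 0 -> x * (y * z * (x^-1 * t)) = z * (y * t).
  by move=> x0; field.
exact: shuffle.
Qed.

Lemma gbin0 a : gbin a 0 = 1.
Proof. by rewrite /gbin big_ord0 divr1. Qed.

(** The recursion is the coefficient form of (1+y) f' = b f, whose solution is determined by its
    constant term. Several identities for (1+y)^b below reduce to it. *)
Lemma eq_by_ode (b : CC) (f h : nat -> CC) :
  f 0%N = h 0%N ->
  (forall n, n.+1%:R * f n.+1 = (b - n%:R) * f n) ->
  (forall n, n.+1%:R * h n.+1 = (b - n%:R) * h n) -> f =1 h.
Proof.
move=> fh0 fS hS; elim=> [//|n IHn].
have n0 : n.+1%:R != 0 :> CC by rewrite pnatr_eq0.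
by apply: (mulfI n0); rewrite fS hS IHn.
Qed.

(** The Leibniz rule, read off at y^n. *)
Lemma psmul_derivn a b n :
  n.+1%:R * psmul a b n.+1 =
  psmul (fun i => i.+1%:R * a i.+1) b n + psmul a (fun i => i.+1%:R * b i.+1) n.
Proof.
have -> : n.+1%:R * psmul a b n.+1 =
    \sum_(i < n.+2) (i%:R * a i) * b (n.+1 - i)%N +
    \sum_(i < n.+2) a i * ((n.+1 - i)%N%:R * b (n.+1 - i)%N).
  rewrite /psmul mulr_sumr -big_split; apply: eq_bigr => i _ /=.
  have le_in : (i <= n.+1)%N by rewrite -ltnS.
  by rewrite natrB //; ring.
congr (_ + _).
  rewrite big_ord_recl /= !mul0r add0r; apply: eq_bigr => i _.
  by rewrite /bump /= add1n subSS.
rewrite big_ord_recr /= subnn mul0r mulr0 addr0; apply: eq_bigr => i _.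
by rewrite subSn // -ltnS.
Qed.

Lemma gbin_vandermonde (a b : CC) n : psmul (gbin a) (gbin b) n = gbin (a + b) n.
Proof.
move: n; apply: (@eq_by_ode (a + b)).
- by rewrite /psmul big_ord1 !gbin0 mulr1.
- move=> n; rewrite psmul_derivn /psmul mulr_sumr -big_split.
  apply: eq_bigr => i _ /=; rewrite !gbinS.
  have le_in : (i <= n)%N by rewrite -ltnS.
  by rewrite natrB //; ring.
- exact: gbinS.
Qed.

Lemma gbin_pascal (a : CC) n : gbin (a + 1) n.+1 = gbin a n.+1 + gbin a n.
Proof.
rewrite -gbin_vandermonde psmulC /psmul !big_ord_recl /= big1 => [|i _].
  rewrite /gbin /bump !subn0 !big_ord0 big_ord1 /= subr0 !divr1 !mul1r.
  by rewrite subSS subn0 addr0.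
by rewrite {1}/gbin !big_ord_recl /= /bump /= add1n !subr0 subrr mul0r mulr0 !mul0r.
Qed.

Lemma gbin_nat m n : gbin m%:R n = 'C(m, n)%:R.
Proof.
elim: n m => [|n IHn] m; first by rewrite gbin0 bin0.
elim: m => [|m IHm].
  by rewrite /gbin big_ord_recl /= subrr !mul0r bin0n.
by rewrite -natr1 gbin_pascal IHm IHn binS natrD.
Qed.

Lemma gbinN1 n : gbin (-1) n = (-1) ^+ n.
Proof.
move: n; apply: (@eq_by_ode (-1)); first by rewrite gbin0.
  exact: gbinS.
by move=> n; rewrite exprS -nat1r; ring.
Qed.

(** The coefficients of e^(xt) as a series in t. *)
Definition exps (x : CC) (j : nat) : CC := x ^+ j / j`!%:R.

Lemma exps0 x : exps x 0 = 1.
Proof. by rewrite /exps divr1. Qed.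

Lemma expsS x j : j.+1%:R * exps x j.+1 = x * exps x j.
Proof.
rewrite /exps exprS factS natrM.
have j0 : j.+1%:R != 0 :> CC by rewrite pnatr_eq0.
have shuffle (a b c d : CC) : a != 0 -> a * (b * c * (a^-1 * d)) = b * (c * d).
  by move=> a0; field.
by rewrite invfM; exact: shuffle.
Qed.

Lemma expsN (x : CC) j : exps (- x) j = (-1) ^+ j * exps x j.
Proof. by rewrite /exps [(- x) ^+ j]exprNn -mulrA. Qed.

Lemma expsD (x y : CC) n : psmul (exps x) (exps y) n = exps (x + y) n.
Proof.
elim: n => [|n IHn]; first by rewrite /psmul big_ord1 !exps0 mulr1.
have n0 : n.+1%:R != 0 :> CC by rewrite pnatr_eq0.
apply: (mulfI n0); rewrite psmul_derivn expsS -IHn mulrDl; congr (_ + _).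
  by rewrite /psmul mulr_sumr; apply: eq_bigr => i _; rewrite expsS mulrA.
by rewrite /psmul mulr_sumr; apply: eq_bigr => i _; rewrite expsS mulrCA.
Qed.

(** * Powers of log(1+y) *)

(** This is log(1+y) itself, whereas [logL] is log(1+y)/y, whose constant term 1 allows negative
    powers. *)
Definition logS (m : nat) : CC := if m is m'.+1 then logL m' else 0.

Lemma pspow_logS j n : pspow logS j (j + n) = pspow logL j n.
Proof.
elim: j n => [//|j IHj] n; rewrite /= /psmul big_ord_recl /= mul0r add0r.
have le_n : (n.+1 <= j.+1 + n)%N by lia.
rewrite [RHS](big_ord_widen_cond (j.+1 + n)%N predT
  (fun i => logL i * pspow logL j (n - i)%N)) //= [RHS]big_mkcond /=.
apply: eq_bigr => -[i lti] _ /=; rewrite /bump /= add1n.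
case: ltnP => le_in.
  by rewrite -IHj; congr (_ * pspow logS j _); lia.
by rewrite pspow_low ?mulr0 //; lia.
Qed.

Lemma pspow_derivn f j n :
  n.+1%:R * pspow f j.+1 n.+1
  = j.+1%:R * psmul (pspow f j) (fun i => i.+1%:R * f i.+1) n.
Proof.
elim: j n => [|j IHj] n.
  rewrite /= mul1r psmul_derivn psmulC [X in _ + X]big1 ?addr0 // => i _.
  by rewrite /ps1 /= !mulr0.
rewrite [pspow f j.+2]/= psmul_derivn -/(pspow f j.+1) psmulC.
have -> : psmul f (fun i => i.+1%:R * pspow f j.+1 i.+1) n
    = j.+1%:R * psmul (pspow f j.+1) (fun i => i.+1%:R * f i.+1) n.
  rewrite (eq_psmul (c' := f)
    (d' := fun i => j.+1%:R * psmul (pspow f j) (fun i => i.+1%:R * f i.+1) i)) //.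
  rewrite [pspow f j.+1]/= -psmulA {1 2}/psmul mulr_sumr.
  by apply: eq_bigr => i _; rewrite mulrCA.
by rewrite -[j.+2%:R]natr1 mulrDl mul1r addrC.
Qed.

(** This is (1+y)^b = e^(b log(1+y)); the index n - j arises because log(1+y)^j is y^j times the
    j-th power of [logL]. *)
Lemma gbin_exp_log (b : CC) n :
  gbin b n = \sum_(j < n.+1) exps b j * pspow logL j (n - j)%N.
Proof.
pose H m : CC := \sum_(j < m.+1) exps b j * pspow logS j m.
have HE N m : (m < N)%N -> H m = \sum_(j < N) exps b j * pspow logS j m.
  move=> ltmN; rewrite /H (big_ord_widen_cond N predT
    (fun j => exps b j * pspow logS j m)) //= big_mkcond.
  by apply: eq_bigr => k _; case: ltnP => // ltmk; rewrite pspow_low ?mulr0.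
transitivity (H n); last first.
  apply: eq_bigr => -[j ltj] _ /=; congr (_ * _).
  by rewrite -pspow_logS subnKC.
(* [H] is e^(b log(1+y)) and [K] is H/(1+y). Then H' = b K and (1+y) K = H combine to the
   differential equation of [eq_by_ode]. *)
pose K m := psmul H (fun i => (-1) ^+ i) m.
have HK m : m.+1%:R * H m.+1 = b * K m.
  rewrite /H mulr_sumr big_ord_recl /= !mulr0 add0r.
  transitivity (b * \sum_(j < m.+1) exps b j *
       psmul (pspow logS j) (fun i => (-1) ^+ i) m).
    rewrite mulr_sumr; apply: eq_bigr => j _; rewrite /bump add1n mulrCA pspow_derivn.
    rewrite mulrCA mulrA expsS -mulrA; congr (_ * (_ * _)).
    apply: eq_psmul => // i _; rewrite /= /logL mulrCA divff ?mulr1 //.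
    by rewrite pnatr_eq0.
  congr (_ * _); rewrite /K /psmul.
  under eq_bigr => j _ do rewrite mulr_sumr.
  rewrite exchange_big /=; apply: eq_bigr => i _.
  by rewrite (HE m.+1) // mulr_suml; apply: eq_bigr => j _; rewrite mulrA.
have KS m : K m.+1 = H m.+1 - K m.
  rewrite /K /psmul big_ord_recr /= subnn mulr1 addrC; congr (_ + _).
  rewrite -sumrN; apply: eq_bigr => i _; rewrite subSn -1?ltnS //.
  by rewrite exprS mulN1r mulrN.
move: n; apply: (@eq_by_ode b).
- by rewrite gbin0 /H big_ord1 exps0 mulr1.
- exact: gbinS.
move=> [|n]; rewrite HK.
  by rewrite /K /psmul big_ord1 /= mulr1 subr0.
by rewrite KS mulrBr -HK -mulrBl.
Qed.

Lemma logL0 : logL 0 = 1.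
Proof. by rewrite /logL divr1. Qed.

Lemma rescoef_eq0 a M (e : int) : M%:Z < e -> rescoef a M e = 0.
Proof. by move=> lt_Me; rewrite /rescoef leNgt lt_Me. Qed.

(** Expand (1+y)^b as e^(b log(1+y)): the factor log(1+y)^j raises the exponent e to e + j. Terms
    with e + j > M vanish, so every N beyond M - e gives the full sum. *)
Lemma rescoef_exp (a b : CC) M (e : int) N : M%:Z - e < N%:Z ->
  \sum_(j < N) exps b j * rescoef a M (e + j%:Z) = rescoef (a + b) M e.
Proof.
move=> ltN; case: (lerP e M%:Z) => [le_eM|lt_Me]; last first.
  rewrite rescoef_eq0 // big1 // => j _.
  by rewrite rescoef_eq0 ?mulr0 //; lia.
pose m := absz (M%:Z - e)%R; pose A := psmul (binser a) (pspowz logL e).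
have ltmN : (m < N)%N by rewrite /m; lia.
transitivity (\sum_(j < m.+1) exps b j * psmul (pspow logL j) A (m - j)%N).
  rewrite [RHS](big_ord_widen_cond N predT
    (fun j => exps b j * psmul (pspow logL j) A (m - j)%N)) //= [RHS]big_mkcond /=.
  apply: eq_bigr => -[j ltj] _ /=; case: ifP => le_jm; last first.
    by rewrite rescoef_eq0 ?mulr0 //; lia.
  rewrite /rescoef ifT; last lia.
  have -> : absz (M%:Z - (e + j%:Z))%R = (m - j)%N by lia.
  rewrite (eq_psmul (c' := binser a) (d' := psmul (pspowz logL e) (pspow logL j))) //.
    by rewrite psmulA psmulC.
  by move=> i _; rewrite pspowzD // logL0.
rewrite {1}/rescoef le_eM -/m.
rewrite (eq_psmul (c' := psmul (binser b) (binser a)) (d' := pspowz logL e)) //.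
  rewrite -psmulA -/A /psmul.
  pose F j l := exps b j * pspow logL j l * A (m - j - l)%N.
  transitivity (\sum_(i < m.+1) \sum_(j < i.+1) F j (i - j)%N).
    rewrite exchange_triangle; apply: eq_bigr => j _.
    rewrite mulr_sumr subSn -1?ltnS //.
    by apply: eq_bigr => l _; rewrite /F mulrA.
  apply: eq_bigr => -[i lti] _; rewrite /binser gbin_exp_log mulr_suml.
  apply: eq_bigr => -[j ltj] _ /=; rewrite /F; congr (_ * A _).
  by move: ltj => /=; lia.
by move=> i _; rewrite psmulC gbin_vandermonde.
Qed.

(** Splits (1+y)^(a+1) as (1+y)^a + y (1+y)^a. *)
Lemma rescoef_pascal (a : CC) M (e : int) :
  rescoef (a + 1) M.+1 e = rescoef a M.+1 e + rescoef a M e.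
Proof.
case: (ltgtP e M.+1%:Z) => [lt_eM|gt_eM|->].
- rewrite /rescoef !ifT; [|lia..].
  have -> : absz (M.+1%:Z - e)%R = (absz (M%:Z - e)%R).+1 by lia.
  rewrite ![psmul (binser _) _ _]psmulC /psmul big_ord_recr /=.
  rewrite [X in _ = X + _]big_ord_recr /= subnn /binser !gbin0.
  rewrite [RHS]addrAC -big_split /=; congr (_ + _).
  by apply: eq_bigr => i _; rewrite subSn -1?ltnS // gbin_pascal mulrDr.
- rewrite (@rescoef_eq0 (a + 1) M.+1) // (@rescoef_eq0 a M.+1) // add0r.
  by rewrite rescoef_eq0 //; lia.
- rewrite (@rescoef_eq0 a M) ?addr0; last lia.
  by rewrite /rescoef lexx subrr /= /psmul !big_ord1 /binser !gbin0.
Qed.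

Lemma rescoef_e0 (a : CC) M : rescoef a M 0 = gbin a M.
Proof. by rewrite /rescoef subr0 (_ : pspowz logL 0 = ps1) ?psmuls1. Qed.

Lemma rescoef_diag (a : CC) M : rescoef a M M%:Z = 1.
Proof.
rewrite /rescoef lexx subrr /= /psmul big_ord1 /binser gbin0 mul1r.
by elim: M => //= M IHM; rewrite /psmul big_ord1 /= logL0 IHM mulr1.
Qed.

Lemma gbin_exp_rescoef (a b : CC) K :
  gbin (a + b) K = \sum_(j < K.+1) exps b j * rescoef a K j%:Z.
Proof.
rewrite -rescoef_e0 -(@rescoef_exp a b K 0 K.+1); last lia.
by apply: eq_bigr => j _; rewrite add0r.
Qed.

(** * Alternating binomial sums *)

(** The coefficients of (1 - S)^k for a shift S, and likewise of (x1 - x2)^k. *)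
Definition altbin (k s : nat) : CC := (-1) ^+ s * 'C(k, s)%:R.

Lemma altbin_rev k s : (s <= k)%N -> altbin k (k - s) = (-1) ^+ k * altbin k s.
Proof.
move=> le_sk; rewrite /altbin bin_sub // mulrA -exprD.
congr (_ * _); rewrite -[in LHS]signr_odd -[in RHS]signr_odd; congr (_ ^+ _).
by rewrite oddB // oddD.
Qed.

Lemma signz_shift (B n : nat) :
  (-1 : CC) ^+ (B + n) * (-1) ^ (B%:Z - n%:Z - 1) = -1.
Proof.
have N0 : (-1 : CC) != 0 by rewrite oppr_eq0 oner_eq0.
rewrite !expfzDr // -exprnN exprN1 invrN1 invr_sign -exprnP exprD.
by rewrite mulrN1 mulrN mulrACA -!expr2 !sqrr_sign mulr1.
Qed.

Section AlternatingSums.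
Variable W : lmodType CC.

Lemma altbinS_sum k (h : nat -> W) :
  \sum_(s < k.+2) altbin k.+1 s *: h s
  = \sum_(s < k.+1) altbin k s *: (h s - h s.+1).
Proof.
under [RHS]eq_bigr => s _ do rewrite scalerBr.
rewrite sumrB big_ord_recl [X in _ = X - _]big_ord_recl -addrA.
congr (_ + _); first by rewrite /altbin !bin0.
transitivity (\sum_(s < k.+1)
    (altbin k s.+1 *: h s.+1 - altbin k s *: h s.+1)).
  apply: eq_bigr => s _; rewrite lift0 -scalerBl; congr (_ *: _).
  by rewrite /altbin binS natrD exprS; ring.
rewrite sumrB; congr (_ - _); rewrite big_ord_recr /=.
by rewrite {2}/altbin bin_small // mulr0 scale0r addr0.
Qed.

(** By hypothesis a difference in i lowers m by one, and the left-hand side is a k-fold difference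
    in i. *)
Lemma altbin_diff k (phi : nat -> nat -> W) M :
  (forall i m, phi i.+1 m.+1 = phi i m.+1 + phi i m) ->
  \sum_(s < k.+1) altbin k s *: phi (k - s)%N (M + k)%N = phi 0%N M.
Proof.
move=> phiS; elim: k => [|k IHk].
  by rewrite big_ord1 addn0 /altbin bin0 mulr1 scale1r.
rewrite (altbinS_sum k (fun s => phi (k.+1 - s)%N (M + k.+1)%N)) -IHk.
apply: eq_bigr => -[s lts] _ /=; congr (_ *: _).
by rewrite subSn // addnS phiS subSS addrC addKr.
Qed.

(* With S the shift of sequences, the left-hand side is the value at 0 of
   (1 - S)^(-K-1) applied to (1 - S)^(K+1) q. *)
Lemma altbin_inverse K (q : nat -> W) n :
  (forall i, (n <= i)%N -> q i = 0) ->
  \sum_(t < n) 'C(K + t, K)%:R *: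
    \sum_(j < K.+2) altbin K.+1 j *: q (t + j)%N = q 0%N.
Proof.
move=> q0; elim: K => [|K IHK].
  transitivity (\sum_(t < n) - (q t.+1 - q t)).
    apply: eq_bigr => t _; rewrite bin0 scale1r.
    rewrite (altbinS_sum 0 (fun j => q (t + j)%N)) big_ord1.
    by rewrite /altbin bin0 mulr1 scale1r addn0 addn1 opprB.
  rewrite sumrN -(big_mkord xpredT (fun t => q t.+1 - q t)) telescope_sumr //.
  by rewrite q0 // sub0r opprK.
rewrite -IHK; pose h t := \sum_(j < K.+2) altbin K.+1 j *: q (t + j)%N.
have h0 t : (n <= t)%N -> h t = 0.
  by move=> le_nt; apply: big1 => j _; rewrite q0 ?scaler0 //; lia.
transitivity (\sum_(t < n) 'C(K.+1 + t, K.+1)%:R *: (h t - h t.+1)).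
  apply: eq_bigr => t _; congr (_ *: _).
  rewrite (altbinS_sum K.+1 (fun j => q (t + j)%N)) -sumrB.
  by apply: eq_bigr => j _; rewrite -scalerBr addSnnS.
have h0n : h n = 0 by exact: h0.
clear h0 q0 IHK.
have -> : \sum_(t < n) 'C(K + t, K)%:R *: \sum_(j < K.+2) altbin K.+1 j *: q (t + j)%N
  = \sum_(t < n) 'C(K + t, K)%:R *: h t by [].
(* The vanishing boundary term turns the claim into Abel summation, an identity valid for every h
   and thus open to induction on n. *)
have -> : \sum_(t < n) 'C(K + t, K)%:R *: h t =
   \sum_(t < n) 'C(K + t, K)%:R *: h t - 'C(K + n, K.+1)%:R *: h n.
  by rewrite h0n scaler0 subr0.
elim: n {h0n} => [|n IHn].
  by rewrite !big_ord0 addn0 bin_small // scale0r subr0.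
rewrite !big_ord_recr /= IHn scalerBr addnS !addSn binS natrD scalerDl.
by rewrite !addrA subrK.
Qed.

(** The relations extend from powers to all polynomials evaluated at the nodes; the product of the
    factors belonging to the other nodes then isolates [q t]. *)
Lemma vandermonde_free (n : nat) (x : nat -> CC) (q : nat -> W) :
  (forall i j, (i < n)%N -> (j < n)%N -> x i = x j -> i = j) ->
  (forall j, \sum_(t < n) (x t) ^+ j *: q t = 0) ->
  forall t, (t < n)%N -> q t = 0.
Proof.
move=> injx sum0 t ltn.
have horner0 (h : {poly CC}) : \sum_(i < n) h.[x i] *: q i = 0.
  under eq_bigr => i _ do rewrite horner_coef scaler_suml.
  rewrite exchange_big big1 //= => j _.
  under eq_bigr => i _ do rewrite -scalerA.
  by rewrite -scaler_sumr sum0 scaler0.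
pose h : {poly CC} := \prod_(s < n | s != t :> nat) ('X - (x s)%:P).
have := horner0 h; rewrite (bigD1 (Ordinal ltn)) //= big1 ?addr0 => [|i neit].
  move/eqP; rewrite scaler_eq0 => /orP[|/eqP//].
  rewrite horner_prod prodf_seq_eq0 => /hasP[s _ /andP[nest]].
  rewrite hornerXsubC subr_eq0 => /eqP xts.
  by case/eqP: nest; apply: injx.
rewrite horner_prod (bigD1 i) /=; last by rewrite -val_eqE in neit.
by rewrite hornerXsubC subrr mul0r scale0r.
Qed.

End AlternatingSums.

Lemma expm1powE k l : expm1pow k l = \sum_(s < k.+1) altbin k s * exps (k - s)%:R l.
Proof.
rewrite /expm1pow mulr_suml (reindex_inj rev_ord_inj) /=.
apply: eq_bigr => s _; have le_sk : (s <= k)%N by rewrite -ltnS.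
by rewrite subSS subKn // bin_sub // /altbin /exps mulrA.
Qed.

Lemma psmul_expm1pow_exps k x m :
  psmul (expm1pow k) (exps x) m = \sum_(s < k.+1) altbin k s * exps ((k - s)%:R + x) m.
Proof.
rewrite /psmul; under eq_bigr => i _ do rewrite expm1powE mulr_suml.
rewrite exchange_big; apply: eq_bigr => s _ /=.
by rewrite -expsD /psmul mulr_sumr; apply: eq_bigr => i _; rewrite mulrA.
Qed.

Lemma expm1powS k l :
  expm1pow k.+1 l = psmul (fun i => exps 1 i - ps1 i) (expm1pow k) l.
Proof.
have -> : psmul (fun i => exps 1 i - ps1 i) (expm1pow k) l
    = psmul (expm1pow k) (exps 1) l - expm1pow k l.
  rewrite [in RHS]psmulC -[X in _ = _ - X](psmul1s (expm1pow k)) /psmul -sumrB.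
  by apply: eq_bigr => i _; rewrite mulrBl.
rewrite psmul_expm1pow_exps expm1powE [in RHS]expm1powE -sumrB.
have := @altbinS_sum CC^o k (fun s => exps (k.+1 - s)%:R l) => /= ->.
apply: eq_bigr => s _; rewrite /= -mulrBr; congr (_ * (exps _ _ - _)).
by rewrite subSn -1?ltnS // natr1.
Qed.

(** Coefficient form of (e^(-x) - 1)^k = (-1)^k e^(-kx) (e^x - 1)^k, multiplied by e^(-bx). *)
Lemma expm1pow_skew k (b : CC) m :
  psmul (fun l => (-1) ^+ l * expm1pow k l) (exps (- b)) m
  = (-1) ^+ k * psmul (exps (- (b + k%:R))) (expm1pow k) m.
Proof.
rewrite [in RHS]psmulC psmul_expm1pow_exps.
transitivity (\sum_(s < k.+1) altbin k s * exps (- (k - s)%:R - b) m).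
  rewrite /psmul.
  under eq_bigr => i _ do rewrite expm1powE mulr_sumr mulr_suml.
  rewrite exchange_big; apply: eq_bigr => s _ /=.
  rewrite -expsD /psmul mulr_sumr; apply: eq_bigr => i _.
  by rewrite (expsN (k - s)%:R) -!mulrA mulrCA; congr (_ * _); rewrite mulrCA.
rewrite mulr_sumr [LHS](reindex_inj rev_ord_inj) /=; apply: eq_bigr => s _.
have le_sk : (s <= k)%N by rewrite -ltnS.
rewrite subSS altbin_rev // -mulrA subKn //; congr (_ * (_ * exps _ _)).
by rewrite natrB //; ring.
Qed.

(** At x = log(1+y) the series (e^x - 1)^k becomes y^k, which lowers the extracted degree from M + k
    to M. *)
Lemma rescoef_expm1pow (a : CC) M k (e : int) N : (M + k)%:Z - e < N%:Z ->
  \sum_(l < N) expm1pow k l * rescoef a (M + k) (e + l%:Z) = rescoef a M e.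
Proof.
move=> ltN; under eq_bigr => l _ do rewrite expm1powE mulr_suml.
rewrite exchange_big /=.
transitivity (\sum_(s < k.+1) altbin k s * rescoef (a + (k - s)%:R) (M + k) e).
  apply: eq_bigr => s _; rewrite -(rescoef_exp a _ ltN) mulr_sumr.
  by apply: eq_bigr => l _; rewrite mulrA.
have := @altbin_diff CC^o k (fun i m => rescoef (a + i%:R) m e) M => /= ->.
  by rewrite addr0.
by move=> i m; rewrite -natr1 addrA rescoef_pascal.
Qed.

Lemma alt_bin_shift m (A : nat -> CC) L :
  \sum_(i < L.+1) ((-1) ^+ i * 'C(m.+1 + i, i)%:R) * (A i.+1 + A i)
  = \sum_(i < L.+1) ((-1) ^+ i * 'C(m + i, i)%:R) * A i
    + ((-1) ^+ L * 'C(m.+1 + L, L)%:R) * A L.+1.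
Proof.
elim: L => [|L IHL]; first by rewrite !big_ord1 !bin0; ring.
rewrite big_ord_recr /= IHL [in RHS]big_ord_recr /=.
by rewrite addSn !addnS binS natrD exprS; ring.
Qed.

(** This turns the coefficients in the bullet product into those of (x1 - x2)^(-k-1). Induction on
    m: the case m = 0 telescopes by Pascal's rule, and the bound on N makes each boundary binomial
    vanish. *)
Lemma bullet_coef m N k L : (N <= m + L.+1 + k)%N ->
  \sum_(i < L.+1) ((-1) ^+ i * 'C(m + i, i)%:R) * 'C(N, m + i + k.+1)%:R
  = (if m < N then 'C(N - m.+1, k) else 0)%N%:R :> CC.
Proof.
elim: m N => [|m IHm] [|N] leN.
- by apply: big1 => i _; rewrite bin0n addnS mulr0.
- rewrite subSS subn0 /=.
  have -> : 'C(N, k)%:R = 'C(N, k)%:R - (-1) ^+ L.+1 * 'C(N, L.+1 + k)%:R :> CC.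
    by rewrite (@bin_small N (L.+1 + k)) ?mulr0 ?subr0 //; lia.
  elim: L {leN} => [|L IHL].
    by rewrite big_ord1 bin0 !add0n binS natrD add1n; ring.
  rewrite big_ord_recr /= IHL add0n binn addnS binS natrD !addSn.
  by rewrite !exprS; ring.
- by apply: big1 => i _; rewrite bin0n addnS mulr0.
- have := @alt_bin_shift m (fun i => 'C(N, m + i + k.+1)%:R) L.
  rewrite [in X in _ = _ + X](@bin_small N) ?mulr0 ?addr0; last lia.
  rewrite IHm; last lia.
  move=> shift; rewrite subSS ltnS -shift; apply: eq_bigr => i _.
  by congr (_ * _); rewrite !addSn !addnS binS natrD.
Qed.

(** The cut-off chosen by epsilon and the given one are both compared with a longer sum. If the
    chosen one lies below [lo], the extra terms counted by [absz] are zero. *)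
Lemma fsumE (M : zmodType) (lo : int) (f : int -> M) (n : nat) :
  (forall i : int, lo + n%:Z <= i -> f i = 0) ->
  fsum lo f = \sum_(t < n) f (lo + t%:Z).
Proof.
move=> f0; rewrite /fsum.
have := ClassicalEpsilon.epsilon_spec (inhabits (0 : int))
  (fun N : int => forall i : int, N <= i -> f i = 0)
  (ex_intro _ (lo + n%:Z) f0).
set N := ClassicalEpsilon.epsilon _ _ => N0.
have trim m k : (m <= k)%N ->
    (forall t, (m <= t)%N -> f (lo + t%:Z) = 0) ->
    \sum_(t < k) f (lo + t%:Z) = \sum_(t < m) f (lo + t%:Z).
  move=> le_mk fm; rewrite [RHS](big_ord_widen_cond k predT
    (fun t : nat => f (lo + t%:Z))) //= [RHS]big_mkcond /=.
  by apply: eq_bigr => t _; case: ltnP => // le_mt; rewrite fm.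
rewrite big_mkord; set m := absz _.
transitivity (\sum_(t < (m + n)%N) f (lo + t%:Z)).
  apply/esym/trim; first exact: leq_addr.
  by move=> t le_t; apply: N0; rewrite /m in le_t; lia.
apply: trim; first exact: leq_addl.
by move=> t le_t; apply: f0; lia.
Qed.

(** * Roots of unity *)

Lemma omegaT_expn T n : omegaT T ^+ n =
  Complex (Rtrigo_def.cos (n%:R * (2 * Rtrigo1.PI / T%:R)))
          (- Rtrigo_def.sin (n%:R * (2 * Rtrigo1.PI / T%:R))).
Proof.
elim: n => [|n IHn].
  by rewrite mul0r Rtrigo_def.cos_0 Rtrigo_def.sin_0 oppr0.
rewrite exprS IHn /omegaT; set t := _ / _.
have cosE : Rtrigo_def.cos (n.+1%:R * t) = Rtrigo_def.cos t * Rtrigo_def.cos (n%:R * t)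
    - Rtrigo_def.sin t * Rtrigo_def.sin (n%:R * t).
  by rewrite -nat1r mulrDl mul1r; exact: Cos_plus.cos_plus.
have sinE : Rtrigo_def.sin (n.+1%:R * t) = Rtrigo_def.sin t * Rtrigo_def.cos (n%:R * t)
    + Rtrigo_def.cos t * Rtrigo_def.sin (n%:R * t).
  by rewrite -nat1r mulrDl mul1r; exact: Rtrigo1.sin_plus.
rewrite cosE sinE; apply/eqP; rewrite eq_complex /=.
by apply/andP; split; apply/eqP; ring.
Qed.

(** If a power with exponent strictly between 0 and T were 1, its half angle y would satisfy cos(2y)
    = 1, hence sin y = 0, although 0 < y < pi. *)
Lemma omegaT_prim T : (0 < T)%N -> T.-primitive_root (omegaT T).
Proof.
move=> T_gt0; have T0 : (T%:R : Rdefinitions.R) != 0 by rewrite pnatr_eq0 -lt0n.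
apply/andP; split=> //; apply/forallP => -[i ltiT] /=; apply/eqP.
rewrite unity_rootE omegaT_expn.
case: (eqVneq i.+1 T) => [->|neiT].
  rewrite mulrCA mulfV // mulr1 /= Rtrigo1.cos_2PI Rtrigo1.sin_2PI oppr0.
  exact: eqxx.
apply/negP; rewrite eq_complex /= => /andP[/eqP cos1 _].
pose y : Rdefinitions.R := i.+1%:R * (Rtrigo1.PI / T%:R).
have PI_gt0 : 0 < Rtrigo1.PI by apply/RltP; exact: Rtrigo1.PI_RGT_0.
have T_gt0' : (0 : Rdefinitions.R) < T%:R by rewrite ltr0n.
have sin_y : 0 < Rtrigo_def.sin y.
  apply/RltP; apply: Rtrigo1.sin_gt_0; apply/RltP.
    by rewrite /y mulr_gt0 ?ltr0n // divr_gt0.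
  rewrite /y mulrCA gtr_pMr // ltr_pdivrMr // mul1r ltr_nat.
  by rewrite ltn_neqAle neiT.
have cosE : Rtrigo_def.cos (2 * y) = 1 - 2 * Rtrigo_def.sin y * Rtrigo_def.sin y.
  exact: Rtrigo1.cos_2a_sin.
move: cos1; rewrite (_ : i.+1%:R * (2 * Rtrigo1.PI / T%:R) = 2 * y); last first.
  by rewrite /y; ring.
rewrite cosE => /eqP; rewrite subr_eq addrC -subr_eq subrr eq_sym !mulf_eq0.
by rewrite (gt_eqF sin_y) pnatr_eq0.
Qed.

(** * Linear maps and sums over integer intervals *)

Section LinearMaps.
Variables (U W : lmodType CC) (f : U -> W).
Hypothesis linf : is_linear f.

Lemma is_linear0 : f 0 = 0.
Proof.
have := linf 1 0 0; rewrite scaler0 addr0 scale1r => /eqP.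
by rewrite -subr_eq0 opprD addrA subrr add0r oppr_eq0 => /eqP.
Qed.

Lemma is_linearZ c x : f (c *: x) = c *: f x.
Proof. by have := linf c x 0; rewrite is_linear0 !addr0. Qed.

Lemma is_linearD x y : f (x + y) = f x + f y.
Proof. by have := linf 1 x y; rewrite !scale1r. Qed.

Lemma is_linear_sum (I : Type) (r : seq I) (P : pred I) (F : I -> U) :
  f (\sum_(i <- r | P i) F i) = \sum_(i <- r | P i) f (F i).
Proof. exact: (big_morph f is_linearD is_linear0). Qed.

Lemma is_linear_lincomb (I : Type) (r : seq I) (P : pred I) (c : I -> CC) (x : I -> U) :
  f (\sum_(i <- r | P i) c i *: x i) = \sum_(i <- r | P i) c i *: f (x i).
Proof. by rewrite is_linear_sum; apply: eq_bigr => i _; apply: is_linearZ. Qed.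

End LinearMaps.

(** A sum over an explicit window. The families below vanish outside a bounded interval, so all
    windows covering it give the same value, and windows can be chosen to suit each argument. *)
Definition isum (W : zmodType) (lo : int) (L : nat) (h : int -> W) : W :=
  \sum_(t < L) h (lo + t%:Z).

Lemma isum_widen (W : zmodType) (lo lo' : int) (L L' : nat) (h : int -> W) :
  lo' <= lo -> lo + L%:Z <= lo' + L'%:Z ->
  (forall a, a < lo -> h a = 0) -> (forall a, lo + L%:Z <= a -> h a = 0) ->
  isum lo L h = isum lo' L' h.
Proof.
move=> le_lo le_hi h_lo h_hi.
have [n1 n1E] : exists n1 : nat, lo = lo' + n1%:Z by exists (absz (lo - lo')%R); lia.
have [n2 n2E] : exists n2 : nat, L' = (n1 + L + n2)%N by exists (L' - n1 - L)%N; lia.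
rewrite /isum n2E !big_split_ord /= [X in _ = X + _ + _]big1 => [|t _]; last first.
  by apply: h_lo; case: t => /= t; lia.
rewrite add0r [X in _ = _ + X]big1 ?addr0 => [|t _]; last by apply: h_hi; lia.
by apply: eq_bigr => t _; congr h; lia.
Qed.

Lemma isum_indep (W : zmodType) (N hi lo lo' : int) (L L' : nat) (h : int -> W) :
  (forall a, a < N -> h a = 0) -> (forall a, hi < a -> h a = 0) ->
  lo <= N -> hi < lo + L%:Z -> lo' <= N -> hi < lo' + L'%:Z ->
  isum lo L h = isum lo' L' h.
Proof.
move=> h_lo h_hi lo1 hi1 lo2 hi2.
pose m := Num.min lo lo'; pose L'' := absz (Num.max (lo + L%:Z) (lo' + L'%:Z) - m)%R.
transitivity (isum m L'' h).
  by apply: isum_widen; rewrite ?/L'' ?/m; do ?[lia];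
     move=> a Ha; [apply: h_lo|apply: h_hi]; lia.
by apply/esym/isum_widen; rewrite ?/L'' ?/m; do ?[lia];
   move=> a Ha; [apply: h_lo|apply: h_hi]; lia.
Qed.

Lemma isum_rev (X : zmodType) (lo : int) (L : nat) (h : int -> X) :
  isum lo L (fun a => h (lo + lo + L%:Z - 1 - a)) = isum lo L h.
Proof.
rewrite /isum (reindex_inj rev_ord_inj) /=; apply: eq_bigr => -[t ltt] _ /=.
by congr h; lia.
Qed.

Section ConvolutionSums.
Variable W : lmodType CC.

Lemma conv_shift (c : nat -> CC) (h : nat -> W) B n :
  conv c (fun m => if (B <= m)%N then h (m - B)%N else 0) n
  = if (B <= n)%N then conv c h (n - B)%N else 0.
Proof.
case: leqP => leBn; last first.
  by apply: big1 => l _; rewrite leqNgt (leq_ltn_trans _ leBn) ?leq_subr ?scaler0.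
rewrite /conv [RHS](big_ord_widen_cond n.+1 predT
  (fun l => c l *: h (n - B - l)%N)) /=; last by rewrite ltnS leq_subr.
rewrite [RHS]big_mkcond; apply: eq_bigr => -[l ltl] _ /=.
have -> : (l < (n - B).+1)%N = (B <= n - l)%N by lia.
by case: ifP => // _; rewrite ?scaler0 // subnAC.
Qed.

Lemma conv_isum (c : nat -> CC) (a : int -> nat -> CC) (q : int -> W) lo L n :
  conv c (fun m => isum lo L (fun i => a i m *: q i)) n
  = isum lo L (fun i => psmul c (a i) n *: q i).
Proof.
rewrite /conv; under eq_bigr => l _ do rewrite scaler_sumr.
rewrite exchange_big; apply: eq_bigr => t _ /=.
by rewrite /psmul scaler_suml; apply: eq_bigr => l _; rewrite scalerA.
Qed.

End ConvolutionSums.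

(** * Twisted modules *)

Section TwistedModule.
Variables (V : lmodType CC) (mode : V -> int -> V -> V) (vac : V).
Hypothesis HV : vertex_algebra mode vac.
Variables (g : V -> V) (T : nat).
Hypothesis T_gt0 : (0 < T)%N.
Variables (W : lmodType CC) (wmode : V -> int -> W -> W).
Hypothesis HW : twisted_phi_module mode vac g T wmode.

(* The coefficient of x^(a/T) in Y_W(u,x), that is, o_(a/T)(u). *)
Definition wcoef (u : V) (a : int) : W -> W := wmode u (- a - T%:Z).

Definition root_exp (a : int) : CC := a%:~R / T%:R.

(** These are the coefficients with total exponent d/T + k, which feed x2^(d/T) once x1 = x2 e^x0 is
    substituted and x2^k is divided out. *)
Definition prodsum_coef u v k w (d a : int) : W :=
  prodcoef T wmode u v k w a (d + T%:Z * k%:Z - a).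

(* With [n] shifted by [B], the coefficient of x0^(n - B) x2^(d/T) in
   Y_W(Y(u,x0)v, x2) w. *)
Definition iter_coef u v (B : nat) (d : int) (w : W) (n : nat) : W :=
  wcoef (mode u (B%:Z - n%:Z - 1) v) d w.

Definition mode_bound u v (B : nat) := forall i : int, B%:Z <= i -> mode u i v = 0.

(** Axiom (iii) at a single vector w. The shift by B clears the pole of Y(u,x0)v, so that series in
    x0 are indexed by natural numbers. *)
Definition assoc_rel u v k w (N : int) : Prop :=
  (forall a b : int, a < N \/ b < N -> prodcoef T wmode u v k w a b = 0) /\
  forall d B lo L, mode_bound u v B ->
    lo <= N -> d + T%:Z * k%:Z - N < lo + L%:Z ->
    forall n, conv (expm1pow k) (iter_coef u v B d w) n
      = if (B <= n)%N then
          isum lo L (fun a => exps (root_exp a) (n - B) *: prodsum_coef u v k w d a)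
        else 0.

Lemma wcoef_linl a w : is_linear (fun u => wcoef u a w).
Proof. exact: (tm_lin_l HW). Qed.

Lemma wcoef_linr u a : is_linear (wcoef u a).
Proof. exact: (tm_lin_r HW). Qed.

Lemma mode0 k v : mode 0 k v = 0.
Proof. exact: (is_linear0 (va_lin_l HV k v)). Qed.

Lemma mode_bound_exists u v : exists B, mode_bound u v B.
Proof.
have [N N0] := va_trunc HV u v; exists (absz N) => i leNi; apply: N0; lia.
Qed.

Lemma mode_bound_le u v B B' : (B <= B')%N -> mode_bound u v B -> mode_bound u v B'.
Proof. by move=> leB HB i lei; apply: HB; lia. Qed.

Lemma prodcoefE u v k w a b :
  prodcoef T wmode u v k w a b =
  \sum_(j < k.+1) altbin k j *:
     wcoef u (a - T%:Z * (k - j)%:Z) (wcoef v (b - T%:Z * j%:Z) w).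
Proof.
apply: eq_bigr => -[j ltj] _ /=; rewrite /wcoef /altbin; congr (_ *: wmode u _ _).
  by rewrite (_ : (k - j)%:Z = k%:Z - j%:Z); [ring | lia].
by congr (wmode v _ w); ring.
Qed.

Lemma prodcoefS u v k w a b :
  prodcoef T wmode u v k.+1 w a b
  = prodcoef T wmode u v k w (a - T%:Z) b - prodcoef T wmode u v k w a (b - T%:Z).
Proof.
rewrite !prodcoefE (altbinS_sum k (fun j =>
  wcoef u (a - T%:Z * (k.+1 - j)%:Z) (wcoef v (b - T%:Z * j%:Z) w))) -sumrB.
apply: eq_bigr => -[j ltj] _ /=; rewrite -scalerBr; congr (_ *: (_ - _)).
  rewrite (_ : (k.+1 - j)%:Z = (k - j)%:Z + 1); last lia.
  by congr (wcoef u _ _); ring.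
rewrite subSS; congr (wcoef u _ (wcoef v _ w)).
by rewrite (_ : j.+1%:Z = j%:Z + 1); [ring | lia].
Qed.

(** * Associativity in coefficient form *)

Lemma assoc_relP u v : exists k : nat, forall w, exists N, assoc_rel u v k w N.
Proof.
have [k Hk] := tm_assoc HW u v; exists k => w.
have [N [supp assoc]] := Hk w; exists N; split=> // d B lo L HB le_lo lt_hi n.
have := assoc (n%:Z - B%:Z) (d + T%:Z * k%:Z).
rewrite /lhscoef (_ : T%:Z * (k%:Z - 1) - (d + T%:Z * k%:Z) = - d - T%:Z); last ring.
rewrite (@fsumE _ 0 _ n.+1); last first.
  by move=> i le_i; rewrite HB ?scaler0 //; lia.
rewrite -/(wcoef _ d w) (is_linear_sum (wcoef_linl d w)) => assocE.
transitivity (rhscoef T wmode u v k w N (n%:Z - B%:Z) (d + T%:Z * k%:Z)).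
  rewrite -assocE; apply: eq_bigr => -[l ltl] _ /=.
  rewrite (is_linearZ (wcoef_linl d w)) add0r /iter_coef.
  by congr (_ *: wcoef (mode u _ v) d w); lia.
rewrite /rhscoef subr_ge0 lez_nat; case: ifP => // leBn.
pose h a := exps (root_exp a) (n - B) *: prodsum_coef u v k w d a.
have h_lo a : a < N -> h a = 0.
  by move=> lta; rewrite /h /prodsum_coef supp ?scaler0 //; left.
have h_hi a : d + T%:Z * k%:Z - N < a -> h a = 0.
  by move=> lta; rewrite /h /prodsum_coef supp ?scaler0 //; right; lia.
pose L' := absz (lo + L%:Z - N)%R.
rewrite (@fsumE _ N _ L'); last first.
  by move=> i le_i; case: ifP => // le_i'; rewrite /L' in le_i; lia.
transitivity (isum N L' h); last first.
  by apply: (isum_indep h_lo h_hi) => //; rewrite /L'; lia.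
apply: eq_bigr => t _; rewrite (_ : absz (n%:Z - B%:Z)%R = (n - B)%N); last lia.
by case: ifP => // /negbT; rewrite -ltNge => /h_hi.
Qed.

Lemma root_expD a : root_exp (a + T%:Z) = root_exp a + 1.
Proof.
rewrite /root_exp intrD mulrDl; congr (_ + _).
by rewrite divff // pnatr_eq0 -lt0n.
Qed.

(** Multiply by x1 - x2, which becomes x2 (e^x0 - 1) after the substitution. Raising k in this way
    lets the products in both orders share one exponent. *)
Lemma assoc_relS u v k w N : assoc_rel u v k w N -> assoc_rel u v k.+1 w N.
Proof.
move=> [supp assoc]; split=> [a b ab_lt|d B lo L HB le_lo lt_hi n].
  by rewrite prodcoefS !supp ?subrr //; case: ab_lt; lia.
have pS a : prodsum_coef u v k.+1 w d a
    = prodsum_coef u v k w d (a - T%:Z) - prodsum_coef u v k w d a.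
  by rewrite /prodsum_coef prodcoefS; congr (_ - _); congr (prodcoef _ _ _ _ _ _ _ _); lia.
have lt_hi' : d + T%:Z * k%:Z - N < lo + L%:Z by lia.
rewrite (eq_conv (d := psmul (fun i => exps 1 i - ps1 i) (expm1pow k))
  (h := iter_coef u v B d w)) //; last by move=> i _; exact: expm1powS.
rewrite -convA; have := assoc d B lo L HB le_lo lt_hi' => assocE.
rewrite (eq_conv (d := fun i => exps 1 i - ps1 i) (fun _ _ => erefl) (fun i _ => assocE i)).
rewrite (conv_shift _ (fun m => isum lo L (fun a =>
  exps (root_exp a) m *: prodsum_coef u v k w d a))).
case: ifP => // leBn; rewrite conv_isum; set j := (n - B)%N.
transitivity (isum lo L (fun a => exps (root_exp a + 1) j *: prodsum_coef u v k w d a)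
  - isum lo L (fun a => exps (root_exp a) j *: prodsum_coef u v k w d a)).
  rewrite /isum -sumrB; apply: eq_bigr => t _; rewrite -scalerBl; congr (_ *: _).
  rewrite -expsD [psmul (exps (root_exp _)) _ _]psmulC.
  rewrite -[X in _ = _ - X]psmul1s /psmul -sumrB.
  by apply: eq_bigr => i _; rewrite mulrBl.
transitivity (isum (lo - T%:Z) L
    (fun a => exps (root_exp a + 1) j *: prodsum_coef u v k w d a)
  - isum lo L (fun a => exps (root_exp a) j *: prodsum_coef u v k w d a)).
  congr (_ - _); apply: (@isum_indep _ N (d + T%:Z * k%:Z - N)); try lia.
    by move=> a lta; rewrite /prodsum_coef supp ?scaler0 //; left.
  by move=> a lta; rewrite /prodsum_coef supp ?scaler0 //; right; lia.
rewrite /isum -sumrB; apply: eq_bigr => t _; rewrite pS scalerBr; congr (_ *: _ - _).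
  by rewrite -root_expD; congr (exps (root_exp _) _); lia.
by congr (prodsum_coef _ _ _ _ _ _); lia.
Qed.

Lemma assoc_rel_add u v k w N m : assoc_rel u v k w N -> assoc_rel u v (k + m) w N.
Proof. by elim: m => [|m IHm] H; rewrite ?addn0 // addnS; apply: assoc_relS; auto. Qed.

(** * Action of residues on the module *)

Lemma wcoef_resY_sum u v B al M d w : mode_bound u v B ->
  wcoef (resY mode al M u v) d w
  = \sum_(m < (M + B).+1) rescoef al M (m%:Z - B%:Z) *: iter_coef u v B d w m.
Proof.
move=> HB; rewrite /resY (@fsumE _ _ _ (M + B).+1); last first.
  by move=> i le_i; rewrite HB ?scaler0 //; lia.
rewrite (is_linear_lincomb (wcoef_linl d w)) (reindex_inj rev_ord_inj) /=.
apply: eq_bigr => -[m ltm] _ /=; rewrite /iter_coef.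
congr (rescoef al M _ *: wcoef (mode u _ v) d w); lia.
Qed.

Lemma isum_gbin u v k w N B al K d lo L :
  assoc_rel u v k w N -> mode_bound u v B ->
  lo <= N -> d + T%:Z * k%:Z - N < lo + L%:Z ->
  isum lo L (fun a => gbin (al + root_exp a) K *: prodsum_coef u v k w d a)
  = \sum_(j < K.+1) rescoef al K j%:Z *: conv (expm1pow k) (iter_coef u v B d w) (B + j).
Proof.
move=> [_ assoc] HB le_lo lt_hi.
transitivity (\sum_(j < K.+1) rescoef al K j%:Z *: isum lo L (fun a =>
    exps (root_exp a) j *: prodsum_coef u v k w d a)).
  rewrite /isum; under [RHS]eq_bigr => j _ do rewrite scaler_sumr.
  rewrite exchange_big; apply: eq_bigr => t _ /=.
  rewrite gbin_exp_rescoef scaler_suml; apply: eq_bigr => j _.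
  by rewrite scalerA mulrC.
apply: eq_bigr => j _; congr (_ *: _).
by rewrite (assoc d B lo L HB le_lo lt_hi) leq_addr addKn.
Qed.

Lemma wcoef_resY u v k w N al M d lo L :
  assoc_rel u v k w N -> lo <= N -> d + T%:Z * k%:Z - N < lo + L%:Z ->
  wcoef (resY mode al M u v) d w
  = isum lo L (fun a => gbin (al + root_exp a) (M + k) *: prodsum_coef u v k w d a).
Proof.
move=> Hrel le_lo lt_hi; have [B HB] := mode_bound_exists u v.
have [_ /(_ d B lo L HB le_lo lt_hi) assoc] := Hrel.
rewrite (wcoef_resY_sum _ _ _ _ HB) (isum_gbin _ _ Hrel HB le_lo lt_hi).
set f := iter_coef u v B d w; pose n := (B + (M + k).+1)%N.
transitivity (\sum_(m < n) rescoef al M (m%:Z - B%:Z) *: f m).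
  rewrite (big_ord_widen_cond n predT
    (fun m => rescoef al M (m%:Z - B%:Z) *: f m)) /=; last by rewrite /n; lia.
  rewrite big_mkcond; apply: eq_bigr => m _ /=; case: ltnP => // lt_m.
  by rewrite rescoef_eq0 ?scale0r //; lia.
(* Insert y^k = (e^x0 - 1)^k, which produces the left-hand side of associativity. *)
transitivity (\sum_(i < n) rescoef al (M + k) (i%:Z - B%:Z) *: conv (expm1pow k) f i).
  pose F j l := (expm1pow k l * rescoef al (M + k) (j%:Z - B%:Z + l%:Z)) *: f j.
  transitivity (\sum_(j < n) \sum_(l < (n - j)%N) F j l).
    apply: eq_bigr => -[m ltm] _ /=; rewrite -scaler_suml rescoef_expm1pow //.
    by rewrite /n; lia.
  rewrite -exchange_triangle; apply: eq_bigr => i _.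
  rewrite /conv scaler_sumr (reindex_inj rev_ord_inj) /=.
  apply: eq_bigr => -[j ltj] _ /=; rewrite /F scalerA subSS subKn // mulrC.
  by congr ((rescoef _ _ _ * _) *: _); lia.
(* Indices below B correspond to negative powers of x0, absent from the right-hand side of
   associativity. *)
rewrite /n big_split_ord /= big1 ?add0r => [|i _]; last first.
  by rewrite assoc leqNgt ltn_ord scaler0.
by apply: eq_bigr => j _; congr (rescoef al _ _ *: _); lia.
Qed.

(** Complements [wcoef_resY], which covers only binomial degrees at least k: here K is arbitrary,
    and it is enough to know that some element of V produces the sum. *)
Lemma isum_gbin_wcoef u v k w N al K d lo L :
  assoc_rel u v k w N -> lo <= N -> d + T%:Z * k%:Z - N < lo + L%:Z ->
  exists x, isum lo L (fun a => gbin (al + root_exp a) K *: prodsum_coef u v k w d a)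
    = wcoef x d w.
Proof.
move=> Hrel le_lo lt_hi; have [B HB] := mode_bound_exists u v.
rewrite (isum_gbin _ _ Hrel HB le_lo lt_hi).
exists (\sum_(j < K.+1) rescoef al K j%:Z *:
  conv (expm1pow k) (fun n => mode u (B%:Z - n%:Z - 1) v) (B + j)).
rewrite (is_linear_lincomb (wcoef_linl d w)); apply: eq_bigr => j _.
by rewrite /conv (is_linear_lincomb (wcoef_linl d w)).
Qed.

(** * Vacuum and derivation *)

Lemma wcoef_vac a w : wcoef vac a w = if a == 0 then w else 0.
Proof.
rewrite /wcoef (tm_vacuum HW); congr (if _ then _ else _).
by apply/eqP/eqP; lia.
Qed.

Lemma root_exp_addM a n : root_exp (a + T%:Z * n%:Z) = root_exp a + n%:R.
Proof.
elim: n => [|n IHn]; first by rewrite mulr0 !addr0.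
rewrite -natr1 addrA -IHn -root_expD; congr root_exp.
by rewrite (_ : n.+1%:Z = n%:Z + 1); [ring | lia].
Qed.

(** Since the vacuum acts as the identity, each term of (x1 - x2)^k contributes at a single a, and
    [altbin_diff] sums the resulting binomials. *)
Lemma wcoef_resY_vac x M d w :
  wcoef (resY mode 0 M x vac) d w = gbin (root_exp d) M *: wcoef x d w.
Proof.
have [k Hk] := assoc_relP x vac; have [N Hrel] := Hk w.
pose c := d + T%:Z * k%:Z.
pose lo := Num.min N d; pose L := absz (Num.max c (c - N) - lo + 1)%R.
rewrite (@wcoef_resY _ _ _ _ _ 0 M d lo L Hrel); try by rewrite /L /lo /c; lia.
transitivity (\sum_(s < k.+1) altbin k s *:
    (gbin (root_exp d + (k - s)%:R) (M + k) *: wcoef x d w)); last first.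
  rewrite (@altbin_diff W k (fun i m => gbin (root_exp d + i%:R) m *: wcoef x d w)).
    by rewrite addr0.
  by move=> i m; rewrite -natr1 addrA gbin_pascal scalerDl.
rewrite /isum; under eq_bigr => t _ do rewrite /prodsum_coef prodcoefE scaler_sumr.
rewrite exchange_big; apply: eq_bigr => -[s lts] _ /=.
have le_sk : (s <= k)%N by [].
(* The position in the window of a = d + T(k - s), the only a at which the s-th term survives. *)
pose t0 := absz (c - T%:Z * s%:Z - lo)%R.
have t0E : lo + t0%:Z = d + T%:Z * (k - s)%:Z.
  have -> : (k - s)%:Z = k%:Z - s%:Z by lia.
  have : T%:Z * s%:Z <= T%:Z * k%:Z by rewrite ler_pM2l ?ltz_nat.
  by rewrite /t0 /c /lo; lia.
have lt_t0 : (t0 < L)%N.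
  have : 0 <= T%:Z * s%:Z by lia.
  have : T%:Z * s%:Z <= T%:Z * k%:Z by rewrite ler_pM2l ?ltz_nat.
  by rewrite /t0 /L /c /lo; lia.
rewrite (bigD1 (Ordinal lt_t0)) //= big1 ?addr0 => [|t net0].
  rewrite t0E add0r root_exp_addM wcoef_vac ifT ?scalerA 1?mulrC.
    by congr (_ *: wcoef x _ w); ring.
  by apply/eqP; rewrite (_ : (k - s)%:Z = k%:Z - s%:Z); [ring|lia].
rewrite wcoef_vac ifF; first by rewrite (is_linear0 (wcoef_linr _ _)) !scaler0.
apply/negbTE; apply: contra net0 => /eqP eq0; rewrite -val_eqE /=; apply/eqP.
have -> : t = absz (lo + t%:Z - lo)%R :> nat by lia.
by rewrite /t0; congr absz; rewrite /c; lia.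
Qed.

(** The identities of [wcoef_resY_vac] for varying M form a unitriangular system in these
    coefficients, solved by strong induction. *)
Lemma wcoef_mode_vac x i d w :
  wcoef (mode x (- 1 - i%:Z) vac) d w = exps (root_exp d) i *: wcoef x d w.
Proof.
have HB : mode_bound x vac 0 by move=> j le_j; apply: (va_creation_reg HV).
pose F m := iter_coef x vac 0 d w m; pose b := root_exp d.
suff FE m : F m = exps b m *: wcoef x d w.
  by rewrite -FE /F /iter_coef; congr (wcoef (mode x _ vac) d w); lia.
elim/ltn_ind: m => M IHM.
have := wcoef_resY_vac x M d w.
rewrite (wcoef_resY_sum _ _ _ _ HB) addn0 -/b -[b]add0r gbin_exp_rescoef scaler_suml.
rewrite big_ord_recr [in RHS]big_ord_recr /= subr0 rescoef_diag scale1r mulr1 add0r.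
have -> : \sum_(m < M) rescoef 0 M (m%:Z - 0) *: iter_coef x vac 0 d w m
  = \sum_(m < M) (exps b m * rescoef 0 M m%:Z) *: wcoef x d w.
  apply: eq_bigr => m _.
  by rewrite subr0 -/(F m) IHM // scalerA mulrC.
by move/addrI.
Qed.

Lemma wcoef_vaD x w : wcoef (vaD mode vac x) 0 w = 0.
Proof.
have := wcoef_mode_vac x 1 0 w; rewrite /vaD => ->.
by rewrite /exps /root_exp expr1 mul0r mul0r scale0r.
Qed.

(** * Skew symmetry and weak commutativity *)

Lemma mode_skew u v (B n : nat) : mode_bound u v B ->
  mode v (B%:Z - n%:Z - 1) u
  = (-1) ^+ (B + n) *: \sum_(i < n.+1) (-1) ^+ i *:
      mode (mode u (B%:Z - (n - i)%:Z - 1) v) (- 1 - i%:Z) vac.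
Proof.
move=> HB; set r := B%:Z - n%:Z - 1.
(* With the vacuum as third vector, p = -1 and q = 0, nonnegative modes kill the vacuum and the
   right-hand side keeps only the term with v_r u. *)
have := va_jacobi HV u v vac (-1) 0 r.
rewrite (@fsumE _ 0 _ n.+1); last first.
  by move=> i le_i; rewrite (HB (r + i)) ?mode0 ?scaler0 // /r; lia.
rewrite (@fsumE _ 0 _ 1); last first.
  move=> i le_i; rewrite (va_creation_reg HV v) ?(va_creation_reg HV u); try lia.
  by rewrite !(is_linear0 (va_lin_r HV _ _)) scaler0 subrr scaler0.
rewrite big_ord1 /= expr0 gbin0 mulr1 scale1r !add0r (va_creation_reg HV) //.
rewrite (is_linear0 (va_lin_r HV _ _)) sub0r (va_creation HV) => E.
have -> : \sum_(i < n.+1) (-1) ^+ i *: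
      mode (mode u (B%:Z - (n - i)%:Z - 1) v) (- 1 - i%:Z) vac
  = - ((-1) ^ r *: mode v r u).
  rewrite -[r in mode v r]subr0 -E; apply: eq_bigr => -[i lti] _ /=.
  rewrite !add0r gbinN1 addr0.
  by congr (_ *: mode (mode u _ v) _ vac); rewrite /r; lia.
by rewrite scalerN scalerA signz_shift scaleN1r opprK.
Qed.

Lemma iter_coef_skew u v B d w n : mode_bound u v B ->
  iter_coef v u B d w n
  = (-1) ^+ (B + n) *: conv (exps (- root_exp d)) (iter_coef u v B d w) n.
Proof.
move=> HB; rewrite /iter_coef (mode_skew n HB) (is_linearZ (wcoef_linl d w)).
rewrite (is_linear_lincomb (wcoef_linl d w)); congr (_ *: _).
by apply: eq_bigr => i _; rewrite wcoef_mode_vac scalerA expsN.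
Qed.

Lemma root_expB a b : root_exp (a - b) = root_exp a - root_exp b.
Proof. by rewrite /root_exp intrD intrN mulrBl. Qed.

Lemma root_exp_inj : injective root_exp.
Proof.
move=> a b /(congr1 (fun x => x * T%:R)).
by rewrite !divfK ?pnatr_eq0 -?lt0n // => /intr_inj.
Qed.

(* Skew symmetry makes the exponential sums over a of the two products agree, and
   exponentials with distinct exponents are linearly independent. *)
Lemma prodcoef_comm u v k w N N' : assoc_rel u v k w N -> assoc_rel v u k w N' ->
  forall a b, prodcoef T wmode v u k w b a = (-1) ^+ k *: prodcoef T wmode u v k w a b.
Proof.
move=> [_ assoc] [_ assoc'] a b.
pose c := a + b; pose d := c - T%:Z * k%:Z.
have [B1 /mode_bound_le HB1] := mode_bound_exists u v.
have [B2 /mode_bound_le HB2] := mode_bound_exists v u.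
pose B := maxn B1 B2.
have HB : mode_bound u v B by apply: HB1; exact: leq_maxl.
have HB' : mode_bound v u B by apply: HB2; exact: leq_maxr.
(* The window from [lo] to c - [lo] is stable under e -> c - e, as [isum_rev] requires. *)
pose lo := Num.min (Num.min N N') (Num.min a b).
pose L := absz (c - lo - lo + 1)%R.
have dc : d + T%:Z * k%:Z = c by rewrite /d subrK.
have {}assoc := assoc d B lo L HB; have {}assoc' := assoc' d B lo L HB'.
have sumE j : isum lo L (fun e => exps (root_exp e) j *:
     (prodsum_coef v u k w d e - (-1) ^+ k *: prodsum_coef u v k w d (c - e))) = 0.
  transitivity (conv (expm1pow k) (iter_coef v u B d w) (B + j) -
    (-1) ^+ k *: isum lo L (fun e => exps (root_exp e) j *: prodsum_coef u v k w d (c - e))).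
    rewrite assoc' ?leq_addr ?addKn; try by rewrite ?dc /L /lo /c; lia.
    rewrite /isum scaler_sumr -sumrB; apply: eq_bigr => t _.
    by rewrite scalerBr !scalerA [exps _ _ * _]mulrC.
  apply/eqP; rewrite subr_eq0; apply/eqP.
  pose f := iter_coef u v B d w; pose be := root_exp d.
  (* Skew symmetry replaces x0 by -x0 and brings in e^(-d x0/T). With [expm1pow_skew] the total
     factor is e^(-c x0/T), which after the sign change exchanges the exponents a and c - a. *)
  transitivity ((-1) ^+ j *: conv (fun l => (-1) ^+ l * expm1pow k l)
      (conv (exps (- be)) f) (B + j)).
    rewrite /conv scaler_sumr; apply: eq_bigr => -[l ltl] _ /=.
    rewrite (iter_coef_skew d w _ HB) -/(conv _ _ _) !scalerA; congr (_ *: _).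
    rewrite [LHS]mulrC [RHS]mulrA; congr (_ * _).
    rewrite -exprD -[in LHS]signr_odd -[in RHS]signr_odd; congr (_ ^+ _).
    by rewrite oddD oddB // !oddD; case: (odd B) (odd j) (odd l) => [] [] [].
  rewrite convA (eq_conv
    (d := fun m => (-1) ^+ k * psmul (exps (- (be + k%:R))) (expm1pow k) m) (h := f)) //;
    last by move=> i _; rewrite expm1pow_skew.
  have -> : conv (fun m => (-1) ^+ k * psmul (exps (- (be + k%:R))) (expm1pow k) m) f (B + j)
    = (-1) ^+ k *: conv (exps (- (be + k%:R))) (conv (expm1pow k) f) (B + j).
    by rewrite convA /conv scaler_sumr; apply: eq_bigr => l _; rewrite scalerA.
  rewrite scalerA mulrC -scalerA; congr (_ *: _).
  have -> : be + k%:R = root_exp c by rewrite -root_exp_addM dc.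
  rewrite (eq_conv (d := exps (- root_exp c)) (fun _ _ => erefl) (fun i _ => assoc _ _ i));
    try by rewrite ?dc /L /lo /c; lia.
  rewrite (conv_shift _ (fun m => isum lo L (fun a =>
     exps (root_exp a) m *: prodsum_coef u v k w d a))) leq_addr addKn conv_isum.
  rewrite -[RHS]isum_rev /isum scaler_sumr; apply: eq_bigr => t _.
  rewrite scalerA expsD (_ : lo + lo + L%:Z - 1 - (lo + t%:Z) = c - (lo + t%:Z)); last first.
    by rewrite /L /lo /c; lia.
  rewrite opprB addrCA subrr addr0; congr (_ *: _).
  by rewrite root_expB -expsN opprD opprK.
pose q t := prodsum_coef v u k w d (lo + t%:Z)
   - (-1) ^+ k *: prodsum_coef u v k w d (c - (lo + t%:Z)).
have q0 t : (t < L)%N -> q t = 0.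
  apply: (@vandermonde_free W L (fun t => root_exp (lo + t%:Z)) q) => [i j _ _|j].
    by move/root_exp_inj/addrI => -[].
  have fact0 : (j`!%:R : CC) != 0 by rewrite pnatr_eq0 -lt0n fact_gt0.
  transitivity (j`!%:R *: (0 : W)); last exact: scaler0.
  rewrite -[in RHS](sumE j) /isum scaler_sumr; apply: eq_bigr => i _.
  by rewrite scalerA /exps mulrC divfK.
pose t0 := absz (b - lo)%R.
have t0E : lo + t0%:Z = b by rewrite /t0 /lo; lia.
have /q0 : (t0 < L)%N by rewrite /t0 /L /lo /c; lia.
have [cb ca] : c - b = a /\ c - a = b by rewrite /c; split; lia.
rewrite /q t0E /prodsum_coef dc cb ca.
by move/eqP; rewrite subr_eq0 => /eqP.
Qed.

Lemma assoc_rel_supp u v k w N N' : assoc_rel u v k w N ->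
  (forall a b : int, a < N' \/ b < N' -> prodcoef T wmode u v k w a b = 0) ->
  assoc_rel u v k w N'.
Proof.
move=> [_ assoc] supp; split=> // d B lo L HB le_lo lt_hi n.
pose c := d + T%:Z * k%:Z; pose lo1 := Num.min lo N.
pose L1 := absz (Num.max (c - N + 1) (lo + L%:Z) - lo1)%R.
rewrite (assoc d B lo1 L1 HB); try by rewrite /L1 /lo1 /c; lia.
case: ifP => // _; apply: (@isum_indep _ N' (c - N')).
- by move=> a lta; rewrite /prodsum_coef supp ?scaler0 //; left.
- by move=> a lta; rewrite /prodsum_coef supp ?scaler0 //; right; rewrite /c in lta; lia.
- by rewrite /lo1; lia.
- by rewrite /L1 /lo1 /c; lia.
- by [].
- by rewrite /c; lia.
Qed.

(** * Products acting on the subspace Omega *)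

Section Omega.
Variable p : nat.

Lemma Omega_wcoef u a w : Omega_tilde T wmode p w -> a < - p%:Z -> wcoef u a w = 0.
Proof. by move=> Hw lta; apply: Hw. Qed.

Lemma Omega_prodcoef u v k w a b : Omega_tilde T wmode p w -> b < - p%:Z ->
  prodcoef T wmode u v k w a b = 0.
Proof.
move=> Hw ltb; rewrite prodcoefE big1 // => j _.
rewrite (Omega_wcoef v Hw) ?(is_linear0 (wcoef_linr _ _)) ?scaler0 //.
have : 0 <= T%:Z * j%:Z by lia.
lia.
Qed.

(** For b < -p the right factor already kills w; for a < -p weak commutativity exchanges the
    factors. The exponent works for both orders, and its positivity allows the expansion in
    [wcoef_wcoef]. *)
Lemma Omega_assoc_rel u v : exists K : nat, forall w, Omega_tilde T wmode p w ->
  assoc_rel u v K.+1 w (- p%:Z).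
Proof.
have [k Hk] := assoc_relP u v; have [k' Hk'] := assoc_relP v u.
exists (k + k')%N => w Hw; have [N relN] := Hk w; have [N' relN'] := Hk' w.
have rel : assoc_rel u v (k + k').+1 w N.
  by rewrite -addnS; exact: assoc_rel_add.
have rel' : assoc_rel v u (k + k').+1 w N'.
  by rewrite addnC -addnS; exact: assoc_rel_add.
apply: (assoc_rel_supp rel) => a b [lta|ltb]; last exact: Omega_prodcoef.
by rewrite (prodcoef_comm rel' rel) Omega_prodcoef ?scaler0.
Qed.

(** Recovers the product from P by expanding (x1 - x2)^(-K-1) in nonnegative powers of x2; the
    hypothesis on v makes the sum finite. *)
Lemma wcoef_wcoef u v K w a b n :
  (forall i : nat, (n <= i)%N -> wcoef v (b - T%:Z * i%:Z) w = 0) ->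
  wcoef u a (wcoef v b w)
  = \sum_(t < n) 'C(K + t, K)%:R *:
      prodcoef T wmode u v K.+1 w (a + T%:Z * (K.+1 + t)%:Z) (b - T%:Z * t%:Z).
Proof.
move=> v0.
have := @altbin_inverse W K
  (fun i => wcoef u (a + T%:Z * i%:Z) (wcoef v (b - T%:Z * i%:Z) w)) n.
rewrite mulr0 addr0 subr0 => <-; last first.
  by move=> i le_i; rewrite v0 // (is_linear0 (wcoef_linr _ _)).
apply: eq_bigr => t _; rewrite prodcoefE; congr (_ *: _).
apply: eq_bigr => -[j ltj] _ /=; congr (_ *: wcoef u _ (wcoef v _ w)).
  rewrite (_ : (K.+1 - j)%:Z = K.+1%:Z - j%:Z) ?PoszD; first by ring.
  by lia.
by rewrite PoszD; ring.
Qed.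

Lemma isum_dvd (X : zmodType) lo m (h : int -> X) :
  (forall s : nat, ~~ (T %| s)%N -> h (lo + s%:Z) = 0) ->
  isum lo (T * m) h = \sum_(s < m) h (lo + T%:Z * s%:Z).
Proof.
move=> h0; elim: m => [|m IHm]; first by rewrite muln0 /isum !big_ord0.
rewrite big_ord_recr /= -IHm /isum mulnSr big_split_ord /=; congr (_ + _).
rewrite (bigD1 (Ordinal T_gt0)) //= addn0 big1 ?addr0 => [|i nei].
  by congr h; lia.
apply: h0; rewrite dvdn_addr ?dvdn_mulr // gtnNdvd //.
by rewrite lt0n; apply: contra nei => /eqP i0; rewrite -val_eqE /= i0.
Qed.

(** * Eigenspaces of g *)

Lemma omega0 : omegaT T != 0.
Proof.
apply/eqP => w0; have := prim_expr_order (omegaT_prim T_gt0).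
by move/eqP; rewrite w0 expr0n -[(T == 0)%N]negbK -lt0n T_gt0 eq_sym oner_eq0.
Qed.

Lemma omegaz_eq1 (z : int) : omegaT T ^ z = 1 -> (T%:Z %| z)%Z.
Proof.
have prim n : omegaT T ^+ n = 1 -> (T %| n)%N.
  by move=> /eqP; rewrite -(prim_order_dvd (omegaT_prim T_gt0)).
case: z => n; rewrite ?NegzE; first exact: prim.
by rewrite -exprnN => /(congr1 GRing.inv); rewrite invrK invr1 => /prim.
Qed.

Lemma wcoef_g u a w : wcoef (g u) a w = omegaT T ^ (- a) *: wcoef u a w.
Proof.
rewrite /wcoef (tm_twist HW) exprz_inv; congr (_ ^ _ *: _); lia.
Qed.

(** Comparing the eigenvalue of g on u with the twist factor of the a-th coefficient forces r + a to
    be divisible by T, unless the coefficient vanishes. *)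
Lemma wcoef_Vr r u a w : in_Vr g T r u -> ~~ (T%:Z %| r%:Z + a)%Z -> wcoef u a w = 0.
Proof.
move=> ur ndvd; have := wcoef_g u a w.
rewrite ur (is_linearZ (wcoef_linl a w)) => /eqP.
rewrite -subr_eq0 -scalerBl scaler_eq0 => /orP[|/eqP//].
rewrite subr_eq0 => /eqP eqr; case/negP: ndvd; apply: omegaz_eq1.
by rewrite expfzDr ?omega0 // -exprnP eqr -expfzDr ?omega0 // addNr.
Qed.

Lemma prodcoef_Vr r u v k w a b : in_Vr g T r u -> ~~ (T%:Z %| r%:Z + a)%Z ->
  prodcoef T wmode u v k w a b = 0.
Proof.
move=> ur ndvd; rewrite prodcoefE big1 // => j _; rewrite (wcoef_Vr _ ur) ?scaler0 //.
apply: contra ndvd => dvd; have -> : r%:Z + a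
    = r%:Z + (a - T%:Z * (k - j)%:Z) + T%:Z * (k - j)%:Z by ring.
by rewrite rpredD // dvdz_mulr.
Qed.

Hypothesis g_lin : is_linear g.
Hypothesis g_order : forall v, iter T g v = v.

Lemma projVr_Vr r u : in_Vr g T r (projVr g T r u).
Proof.
rewrite /in_Vr /projVr (is_linearZ g_lin) (is_linear_lincomb g_lin).
rewrite scalerA mulrC -scalerA; congr (_ *: _).
pose F j := (omegaT T ^+ (r * j))^-1 *: iter j g u.
rewrite scaler_sumr.
have shift j : omegaT T ^+ r *: F j.+1 = (omegaT T ^+ (r * j))^-1 *: g (iter j g u).
  rewrite /F scalerA mulnS exprD invfM mulrA mulfV ?mul1r //.
  by rewrite expf_eq0 (negbTE omega0) andbF.
transitivity (\sum_(j < T) omegaT T ^+ r *: F j.+1).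
  by apply: eq_bigr => j _; rewrite shift.
rewrite -(big_mkord xpredT (fun j => omegaT T ^+ r *: F j.+1)).
rewrite -(big_mkord xpredT (fun j => omegaT T ^+ r *: F j)).
rewrite -[LHS](addKr (omegaT T ^+ r *: F 0%N)).
have -> : omegaT T ^+ r *: F 0%N + \sum_(0 <= j < T) omegaT T ^+ r *: F j.+1
   = \sum_(0 <= j < T) omegaT T ^+ r *: F j + omegaT T ^+ r *: F T.
  by rewrite -(big_nat_recr T 0 (fun j => omegaT T ^+ r *: F j)) // big_nat_recl.
have -> : F T = F 0%N.
  rewrite /F muln0 expr0 mulnC exprM (prim_expr_order (omegaT_prim T_gt0)).
  by rewrite expr1n g_order.
by rewrite addrCA addNr addr0.
Qed.

(** In this residue class the factors from the twist cancel those of the projection, so all T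
    summands are equal. *)
Lemma wcoef_projVr r u a w : (T%:Z %| r%:Z + a)%Z ->
  wcoef (projVr g T r u) a w = wcoef u a w.
Proof.
move=> /dvdzP[z rz]; rewrite /projVr (is_linearZ (wcoef_linl a w)).
rewrite (is_linear_lincomb (wcoef_linl a w)).
have iterE j : wcoef (iter j g u) a w = (omegaT T ^ (- a)) ^+ j *: wcoef u a w.
  elim: j => [|j IHj]; first by rewrite scale1r.
  by rewrite iterS wcoef_g IHj scalerA exprS.
have omegaE : omegaT T ^ (- a) = omegaT T ^+ r.
  have -> : - a = r%:Z - z * T%:Z by lia.
  rewrite expfzDr ?omega0 // -exprnP -mulNr [- z * _]mulrC -exprz_exp -exprnP.
  by rewrite (prim_expr_order (omegaT_prim T_gt0)) exp1rz mulr1.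
under eq_bigr => j _.
  rewrite iterE scalerA omegaE exprM mulVf ?expf_eq0 ?(negbTE omega0) ?andbF // scale1r.
  over.
rewrite sumr_const card_ord -[wcoef u a w *+ T]scaler_nat scalerA mulVf ?scale1r //.
by rewrite pnatr_eq0 -lt0n.
Qed.

Lemma Omega_wcoef_wcoef u v a w : Omega_tilde T wmode p w -> a < - p%:Z ->
  wcoef u a (wcoef v 0 w) = 0.
Proof.
move=> Hw lta; pose r := absz ((- a) %% T%:Z)%Z.
have dvd_ra : (T%:Z %| r%:Z + a)%Z.
  have T0 : T%:Z != 0 by lia.
  have := divz_eq (- a) T%:Z; rewrite /r gez0_abs ?modz_ge0 //.
  set q := divz _ _; set m := modz _ _ => aE.
  have -> : m + a = - q * T%:Z by rewrite -[a]opprK aE; ring.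
  exact: dvdz_mull.
pose u' := projVr g T r u; have u'r : in_Vr g T r u' by exact: projVr_Vr.
rewrite -(wcoef_projVr u _ dvd_ra) -/u'.
have [K /(_ w Hw) Hrel] := Omega_assoc_rel u' v; have [supp _] := Hrel.
have Tp : p%:Z < T%:Z * p.+1%:Z by nia.
pose L := (T * (K.+1 + p.+1))%N.
have hi : a + T%:Z * K.+1%:Z - - p%:Z < a + L%:Z by rewrite /L; nia.
(* This shift makes the binomial at a + Ts equal to binom(s - 1, K): zero for 1 <= s <= K, and
   binom(K + t, K) at s = K + 1 + t, as in [wcoef_wcoef]. *)
have [x sumx] := isum_gbin_wcoef (-1 - root_exp a) K Hrel (ltW lta) hi.
rewrite -(Omega_wcoef x Hw lta) -sumx /L isum_dvd; last first.
  move=> s ndvd; rewrite /prodsum_coef (prodcoef_Vr _ _ _ _ u'r) ?scaler0 //.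
  apply: contra ndvd => dvd; rewrite -[(T %| s)%N]/((T%:Z %| s%:Z)%Z).
  have -> : s%:Z = r%:Z + (a + s%:Z) - (r%:Z + a) by ring.
  by rewrite rpredB.
rewrite (@wcoef_wcoef _ _ K _ _ _ p.+1); last first.
  by move=> i le_i; apply: Omega_wcoef => //; nia.
rewrite big_split_ord /= [X in _ = X + _]big1 ?add0r => [|[s lts] _ /=]; last first.
  (* At s = 0 the upper index is -1 and the binomial is nonzero; the term vanishes because a < -p
     lies outside the support. *)
  case: s lts => [|s] lts.
    by rewrite /prodsum_coef supp ?scaler0 //; left; rewrite mulr0 addr0.
  rewrite root_exp_addM -natr1.
  have -> : -1 - root_exp a + (root_exp a + (s%:R + 1)) = s%:R by ring.
  by rewrite gbin_nat bin_small ?scale0r.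
apply: eq_bigr => t _; rewrite root_exp_addM addSn -natr1.
have -> : -1 - root_exp a + (root_exp a + ((K + t)%:R + 1)) = (K + t)%:R by ring.
rewrite gbin_nat /prodsum_coef; congr (_ *: prodcoef _ _ _ _ _ _ _ _).
by rewrite -addSn PoszD; ring.
Qed.

(** On the support the upper index [al] + a/T is a natural number: a >= -p makes it nonnegative, and
    the bound on the second exponent keeps it below the lower index M + K + 1. The deltas in the
    definition of the product fit these two bounds. *)
Lemma Omega_diamond r u v w : Omega_tilde T wmode p w -> (r < T)%N -> in_Vr g T r u ->
  wcoef (diamond_r mode T p r u v) 0 w = 0.
Proof.
move=> Hw ltrT ur; have [K /(_ w Hw) Hrel] := Omega_assoc_rel u v.
have [supp _] := Hrel; rewrite /diamond_r.
set al := _ + r%:R / T%:R; set M := (_ + _ + _)%N.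
pose L := absz (T%:Z * K.+1%:Z + p%:Z + p%:Z + 1)%R.
rewrite (@wcoef_resY _ _ _ _ _ al M 0 (- p%:Z) L Hrel) //; last by rewrite /L; nia.
apply: big1 => t _; set a := - p%:Z + t%:Z; rewrite /prodsum_coef add0r.
have [dvd|ndvd] := boolP (T%:Z %| r%:Z + a)%Z; last first.
  by rewrite (prodcoef_Vr _ _ _ _ ur) ?scaler0.
have [ltb|leb] := ltrP (T%:Z * K.+1%:Z - a) (- p%:Z).
  by rewrite supp ?scaler0 //; right.
have [s sE] : exists s, r%:Z + a = s * T%:Z by exact/dvdzP.
have pE := divn_eq p T; have nb_lt : (p %% T < T)%N by rewrite ltn_mod.
set m := (p %/ T)%N in pE; set b := (p %% T)%N in pE nb_lt.
have dr : deltaT T (nb T p) r = (r <= b)%N by rewrite /deltaT ltn_eqF.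
(* For r = 0 the convention that delta vanishes at T agrees with the comparison, as b < T. *)
have dTr : deltaT T (nb T p) (T - r) = (T - r <= b)%N.
  rewrite /deltaT; case: eqP => // ->.
  by rewrite -/b leqNgt nb_lt.
have le_a : - p%:Z <= a by rewrite /a; lia.
have lo_s : 0 <= s + m%:Z + ((r <= b)%N : nat)%:Z - 1.
  by case: (leqP r b) => le_rb /=; nia.
have hi_s : s <= K.+1%:Z + m%:Z + ((T - r <= b)%N : nat)%:Z.
  by case: (leqP (T - r) b) => le_rb /=; nia.
pose n := absz (s + m%:Z + ((r <= b)%N : nat)%:Z - 1)%R.
have -> : al + root_exp a = n%:R.
  have T0 : (T%:R : CC) != 0 by rewrite pnatr_eq0 -lt0n.
  have nE : (n%:R : CC) = (s + m%:Z + ((r <= b)%N : nat)%:Z - 1)%:~R.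
    by rewrite -[LHS]/(n%:Z%:~R) /n gez0_abs.
  have aE : root_exp a = s%:~R - r%:R / T%:R.
    rewrite /root_exp (_ : a = s * T%:Z - r%:Z); last by lia.
    by rewrite intrB intrM mulrBl mulfK.
  rewrite nE aE /al dr /fl -/m !intrD /=.
  by rewrite (_ : (-1)%:~R = -1 :> CC) //; ring.
rewrite gbin_nat bin_small ?scale0r // /M dr dTr /fl -/m /n; lia.
Qed.

(** By [bullet_coef] the alternating sum collapses to the coefficients of (x1 - x2)^(-K-1), which
    [wcoef_wcoef] identifies with the composite. *)
Lemma Omega_bullet_r u v w : Omega_tilde T wmode p w -> in_Vr g T 0 u ->
  wcoef (bullet_r mode T p 0 u v) 0 w = wcoef u 0 (wcoef v 0 w).
Proof.
move=> Hw u0; have [K /(_ w Hw) Hrel] := Omega_assoc_rel u v.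
have [supp _] := Hrel; rewrite /bullet_r /=.
set m := fl T p; pose n := (K.+1 + (m.+1 + m.+1))%N.
have pm : p%:Z < T%:Z * m.+1%:Z.
  have pE := divn_eq p T; have nb_lt : (p %% T < T)%N by rewrite ltn_mod.
  by rewrite /m /fl; nia.
rewrite (_ : -1 + _ + _ + _ = m%:R); last first.
  by rewrite /deltaT ltn_eqF //= mul0r addr0 addrAC addNr add0r.
(* A multiple of T below -p: on the multiples of T in the window, a/T = s - m - 1, so the upper
   index m + a/T is s - 1. *)
pose lo := - (T%:Z * m.+1%:Z).
have lo_le : lo <= - p%:Z by rewrite /lo; lia.
have hi : 0 + T%:Z * K.+1%:Z - - p%:Z < lo + (T * n)%:Z by rewrite /lo /n; nia.
rewrite (is_linear_lincomb (wcoef_linl 0 w)).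
pose P s := prodsum_coef u v K.+1 w 0 (lo + T%:Z * s%:Z).
have resE i : wcoef (resY mode m%:R (m + i) u v) 0 w
    = \sum_(s < n) gbin (s%:R - 1) (m + i + K.+1) *: P s.
  rewrite (wcoef_resY _ _ Hrel lo_le hi) isum_dvd; last first.
    move=> s ndvd; rewrite /prodsum_coef (prodcoef_Vr _ _ _ _ u0) ?scaler0 //.
    apply: contra ndvd => dvd; rewrite -[(T %| s)%N]/((T%:Z %| s%:Z)%Z).
    have -> : s%:Z = 0%:Z + (lo + s%:Z) + T%:Z * m.+1%:Z by rewrite /lo; ring.
    by rewrite rpredD // dvdz_mulr.
  apply: eq_bigr => s _; rewrite root_exp_addM; congr (gbin _ _ *: _).
  have -> : root_exp lo = - (m%:R + 1).
    have := root_exp_addM lo m.+1; rewrite /lo addNr natr1.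
    by rewrite /root_exp mul0r => /esym/eqP; rewrite addr_eq0 => /eqP.
  by ring.
transitivity (\sum_(s < n) (\sum_(i < m.+1)
    ((-1) ^+ i * 'C(m + i, i)%:R) * gbin (s%:R - 1) (m + i + K.+1)) *: P s).
  under eq_bigr => i _ do rewrite resE scaler_sumr.
  rewrite exchange_big; apply: eq_bigr => s _ /=.
  by rewrite scaler_suml; apply: eq_bigr => i _; rewrite scalerA.
have termE s : (s < n)%N ->
    (\sum_(i < m.+1) ((-1) ^+ i * 'C(m + i, i)%:R) * gbin (s%:R - 1) (m + i + K.+1)) *: P s
    = (if (m.+1 < s)%N then 'C(s - m.+2, K) else 0)%N%:R *: P s.
  case: s => [|s] lts.
    (* The case s = 0, with upper index -1, is outside the reach of [bullet_coef]; there a = [lo] is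
       outside the support. *)
    by rewrite /P /prodsum_coef supp ?scaler0 //; left; rewrite mulr0 addr0 /lo; lia.
  congr (_ *: _); rewrite -natr1 addrK ltnS subSS -(@bullet_coef m s K m).
    by apply: eq_bigr => i _; rewrite gbin_nat.
  by rewrite /n in lts; lia.
rewrite (eq_bigr (fun s : 'I_n =>
  (if (m.+1 < s)%N then 'C(s - m.+2, K) else 0)%N%:R *: P s)); last first.
  by move=> s _; exact: termE.
rewrite (@wcoef_wcoef _ _ K _ _ _ m.+1); last first.
  by move=> i le_i; apply: Omega_wcoef => //; nia.
(* The first m + K + 2 terms vanish and the remaining m + 1 match those of [wcoef_wcoef]. *)
rewrite /n (_ : (K.+1 + (m.+1 + m.+1) = m.+1 + K.+1 + m.+1)%N); last lia.
rewrite big_split_ord /= big1 ?add0r => [|[s lts] _ /=]; last first.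
  case: ifP => lt_ms; last by rewrite scale0r.
  by rewrite bin_small ?scale0r //; lia.
apply: eq_bigr => t _; rewrite ifT; last lia.
congr (_%:R *: _); first by congr ('C(_, K)); lia.
rewrite /P /prodsum_coef; congr (prodcoef _ _ _ _ _ _ _ _).
  by rewrite /lo !PoszD; ring.
by rewrite /lo !PoszD; ring.
Qed.

End Omega.

End TwistedModule.

(** * Module structure on the subspace Omega *)

Theorem theorem4p3
  (V : lmodType CC) (mode : V -> int -> V -> V) (vac : V)
  (HV : vertex_algebra mode vac)
  (g : V -> V) (T : nat)
  (Hg : va_automorphism mode vac g) (HT : has_order g T)
  (W : lmodType CC) (wmode : V -> int -> W -> W)
  (HW : twisted_phi_module mode vac g T wmode)
  (p : nat) :
  (* Omega~_n(W) is invariant under o(v) *)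
  (forall (v : V) (w : W), Omega_tilde T wmode p w ->
      Omega_tilde T wmode p (ozero T wmode v w)) /\
  (* A~_{g,n}(V)-module structure, v + O~_{g,n}(V) acting as o(v): *)
  (forall (x : V) (w : W), in_Otilde mode vac g T p x ->
      Omega_tilde T wmode p w -> ozero T wmode x w = 0) /\
  (forall w : W, Omega_tilde T wmode p w -> ozero T wmode vac w = w) /\
  (forall (u v : V) (w : W), Omega_tilde T wmode p w ->
      ozero T wmode (bullet mode g T p u v) w
      = ozero T wmode u (ozero T wmode v w)).
Proof.
have [g_lin _ _ _] := Hg; have [T_gt0 g_order _] := HT.
have ozeroE v w : ozero T wmode v w = wcoef T wmode v 0 w.
  by rewrite /ozero /wcoef oppr0 add0r.
have lin0 w := wcoef_linl HW 0 w.
split; last split; last split.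
- move=> v w Hw u a lta; rewrite ozeroE.
  exact: (Omega_wcoef_wcoef HV T_gt0 HW g_lin g_order _ _ Hw).
- move=> x w [m [c [r [a [b [d [Hr ->]]]]]]] Hw.
  rewrite ozeroE (is_linearD (lin0 w)) (is_linear_lincomb (lin0 w)).
  rewrite (wcoef_vaD HV T_gt0 HW) addr0 big1 // => i _; have [lt_r in_r] := Hr i.
  by rewrite (Omega_diamond HV T_gt0 HW _ Hw lt_r in_r) scaler0.
- by move=> w _; rewrite /ozero (tm_vacuum HW) eqxx.
(* Only r = 0 contributes to the bullet product, and projecting u to the fixed points of g does not
   change o(u). *)
- move=> u v w Hw; rewrite !ozeroE /bullet (bigD1 (Ordinal T_gt0)) //=.
  rewrite [X in _ + X]big1 ?addr0 => [|r]; last first.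
    by rewrite -val_eqE /= /bullet_r => /negbTE ->.
  have u0 : in_Vr g T 0 (projVr g T 0 u) by exact: projVr_Vr.
  rewrite (Omega_bullet_r HV T_gt0 HW _ Hw u0).
  by apply: (wcoef_projVr T_gt0 HW); rewrite addr0 dvdz0.
Qed.
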